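(* Let $n,m,d,k$ be positive integers, $N=2^n$, with $N$ large and $d,k\le\sqrt N$. Consider the following problem: there is an unknown function $f:\{0,1\}^n\to\{0,1\}^m$ (the database), accessible only through the parallel-query unitary \[T_f^{\otimes d}:\ket{x_1}\ket{z_1}\cdots\ket{x_d}\ket{z_d}\mapsto \ket{x_1}\ket{z_1\oplus f(x_1)}\cdots\ket{x_d}\ket{z_d\oplus f(x_d)}\] ($x_i\in\{0,1\}^n$, $z_i\in\{0,1\}^m$). We are given $k$ distinct items $y_1,\dots,y_k\in\{0,1\}^m$, with the promise that each $y_i$ is in the image of $f$, and must output, for each $i$, a location $x$ with $f(x)=y_i$, succeeding with probability at least $3/4$. Then there is a quantum algorithm solving this problem such that: (1) if $k\le\sqrt d$, it uses $O\left(\sqrt{N/d}\right)$ applications of $T_f^{\otimes d}$; (2) if $\sqrt d<k\le d\lg d$, it uses $O\left(\sqrt{\frac{Nk\lg d}{d\min\{k,d\}}}\right)$ applications of $T_f^{\otimes d}$; (3) if $d\lg d<k$, it uses $O\left(\frac{\sqrt{Nk}}{d}\right)$ applications of $T_f^{\otimes d}$.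
   Context: Addresses $\{0,1\}^n$ are identified with $\{0,1,\dots,N-1\}$; $\lg$ denotes the base-2 logarithm. One application of $T_f^{\otimes d}$ is called a parallel query (a simultaneous query to $d$ identical copies of the database); the complexity measure is the number of parallel queries. *)

(* Defs.v *)
From mathcomp Require Import all_boot all_order all_algebra.
From mathcomp Require Import reals Rstruct.
From mathcomp.real_closed Require Import complex.
From Stdlib Require Import Reals.

Set Implicit Arguments.
Unset Strict Implicit.
Unset Printing Implicit Defensive.
Import Order.TTheory GRing.Theory Num.Theory.

Definition Bits (n : nat) : finType := {ffun 'I_n -> bool}.

Definition xor_bits (m : nat) (a b : Bits m) : Bits m :=
  [ffun j => xorb (a j) (b j)].

Definition database (n m : nat) := {ffun Bits n -> Bits m}.

(* Computational basis of the query register of d parallel queries: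
   |x_1>|z_1> ... |x_d>|z_d>. *)
Definition QReg (n m d : nat) : finType := {ffun 'I_d -> (Bits n * Bits m)%type}.

Definition par_query (n m d : nat) (f : database n m) (q : QReg n m d) : QReg n m d :=
  [ffun i => ((q i).1, xor_bits (q i).2 (f (q i).1))].

Definition C : Type := R[i].

Local Open Scope ring_scope.

Definition Basis (n m d : nat) (W : finType) : finType := (QReg n m d * W)%type.

Definition apply_op (S : finType) (A : S -> S -> C) (v : S -> C) : S -> C :=
  fun s => \sum_(t : S) A s t * v t.

Definition unitary_op (S : finType) (A : S -> S -> C) : Prop :=
  forall s s' : S, \sum_(t : S) (A t s)^* * A t s' = ((s == s')%:R : C).

Definition unit_vector (S : finType) (v : S -> C) : Prop :=
  \sum_(s : S) (v s)^* * v s = (1 : C).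

Definition oracle_op (n m d : nat) (W : finType) (f : database n m)
  : Basis n m d W -> Basis n m d W -> C :=
  fun s t => (((s.1 == par_query f t.1) && (s.2 == t.2))%:R : C).

Fixpoint run_state (n m d : nat) (W : finType) (f : database n m)
  (psi0 : Basis n m d W -> C) (U : nat -> Basis n m d W -> Basis n m d W -> C)
  (t : nat) : Basis n m d W -> C :=
  match t with
  | 0 => apply_op (U 0%N) psi0
  | t'.+1 => apply_op (U t) (apply_op (@oracle_op n m d W f) (run_state f psi0 U t'))
  end.

Definition meas_prob (S : finType) (psi : S -> C) (P : pred S) : R :=
  \sum_(s : S | P s) complex.Re ((psi s)^* * psi s).

(* There is a quantum algorithm making exactly T parallel queries T_f^{(x)d}
   which, given the k targets y (hard-wired), for every database f in whose
   image every y_i lies, outputs a k-tuple of locations (x_1,...,x_k) with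
   f(x_i) = y_i for all i, with probability at least 3/4. *)
Definition solves_with_queries (n m d k : nat) (y : {ffun 'I_k -> Bits m})
  (T : nat) : Prop :=
  exists (W : finType) (psi0 : Basis n m d W -> C)
         (U : nat -> Basis n m d W -> Basis n m d W -> C)
         (out : Basis n m d W -> {ffun 'I_k -> Bits n}),
    unit_vector psi0 /\
    (forall t : nat, leq t T -> unitary_op (U t)) /\
    (forall f : database n m,
       (forall i : 'I_k, exists x : Bits n, f x = y i) ->
       (3 / 4 <= meas_prob (run_state f psi0 U T)
                   [pred s | [forall i : 'I_k, f (out s i) == y i]])%R).

Local Close Scope ring_scope.
Local Open Scope R_scope.

Definition lg (x : R) : R := ln x / ln 2.

Definition query_bound (n d k : nat) : R :=
  let N := INR (2 ^ n) in
  let dd := INR d in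
  let kk := INR k in
  if Rle_dec kk (sqrt dd) then sqrt (N / dd)
  else if Rle_dec kk (dd * lg dd) then sqrt (N * kk * lg dd / (dd * Rmin kk dd))
  else sqrt (N * kk) / dd.

Arguments solves_with_queries : clear implicits.

(* Main.v *)
(* Everything rests on exact Grover search.  If a block of at most T^2 addresses
   contains exactly one marked address, then T iterations, started from a vector
   whose weight outside the block is tuned so that the total rotation is exactly
   a right angle, find it with certainty; d blocks are searched in parallel.

   Let A be the set of items still unfound and call x wanted if f x = y_i for some
   i in A.  A round permutes the addresses at random, cuts a random sample of
   density P into blocks, and searches all of them: item i is found as soon as one
   of its preimages is sampled and is the only wanted address of its block.  With
   nu wanted addresses and blocks of size w^2, Chebyshev's inequality and a count
   of collisions leave on average at most 4k/P + 4 nu^2 w^2 / N wanted addresses,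
   and the first term disappears when P = 1.  A round costs O(1 + w + P N / (d w)).
   Since each item is counted with all its preimages, multiple preimages do no
   harm: items with many preimages are caught by the sparse samples.

   Put kappa = max(k, d), L = sqrt (N / d), q = sqrt (kappa / d).  Sparse rounds
   bring nu from N down to kappa at total cost O(L q), the cost and the failure
   probability of the successive rounds being geometric.  Rounds with P = 1 then
   bring nu from kappa to d / 2^16 at cost O(L q), and from d 2^(-s^2) to
   d 2^(-(s+1)^2) at cost O(L) each, so sqrt (lg d) + O(1) of these suffice.  When
   k <= sqrt d, three rounds lead from nu = d = t^4 to 512 t^3, t^2 and 1/2.

   Only Gram matrices of the states, indexed by the databases, are tracked: two
   families of vectors with the same Gram matrix differ by a unitary that does not
   depend on the database. *)
Require Import Defs.
From mathcomp Require Import all_boot all_order all_algebra all_fingroup.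
From mathcomp Require Import reals Rstruct.
From mathcomp.real_closed Require Import complex.
From Stdlib Require Import Reals Lra Psatz.
Ltac stdlra := lra.
Ltac stdnra := nra.
Ltac stdring := ring.
Ltac stdfield := field.
From mathcomp Require Import ring lra.

Set Implicit Arguments.
Unset Strict Implicit.
Unset Printing Implicit Defensive.
Import Order.TTheory GRing.Theory Num.Theory.

Delimit Scope nat_scope with N.
Local Open Scope ring_scope.

(** * Gram matrices and query algorithms *)

Section Gram.
Variables (K : realFieldType) (S : finType).
Implicit Types (u v w : S -> K) (A B : S -> S -> K).

Definition dot u v : K := \sum_s u s * v s.

Definition mxapp A v : S -> K := fun s => \sum_t A s t * v t.

Definition orthog A := forall s s', \sum_t A t s * A t s' = (s == s')%:R.

Lemma dotC u v : dot u v = dot v u.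
Proof. by apply: eq_bigr => s _; rewrite mulrC. Qed.

Lemma eq_dot u u' v v' : u =1 u' -> v =1 v' -> dot u v = dot u' v'.
Proof. by move=> eu ev; apply: eq_bigr => s _; rewrite eu ev. Qed.

Lemma dotBl u v w : dot (fun s => u s - v s) w = dot u w - dot v w.
Proof. by rewrite -sumrB; apply: eq_bigr => s _; rewrite mulrBl. Qed.

Lemma dotZl a u v : dot (fun s => a * u s) v = a * dot u v.
Proof. by rewrite mulr_sumr; apply: eq_bigr => s _; rewrite mulrA. Qed.

Lemma dot_eq0 u : dot u u = 0 -> u =1 (fun=> 0).
Proof.
move=> u0 s; have /psumr_eq0P h : forall s, true -> 0 <= u s * u s.
  by move=> t _; rewrite -expr2 sqr_ge0.
by have /eqP := h u0 s isT; rewrite mulf_eq0 orbb => /eqP.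
Qed.

Lemma sum_delta (F : S -> K) s : \sum_t (s == t)%:R * F t = F s.
Proof.
rewrite (bigD1 s) //= eqxx mul1r big1 ?addr0 // => t ts.
by rewrite eq_sym (negPf ts) mul0r.
Qed.

Lemma orthog_dot A u v : orthog A -> dot (mxapp A u) (mxapp A v) = dot u v.
Proof.
move=> oA; rewrite /dot /mxapp.
transitivity (\sum_s \sum_t \sum_t' (u t * v t') * (A s t * A s t')).
  apply: eq_bigr => s _; rewrite mulr_suml; apply: eq_bigr => t _.
  by rewrite mulr_sumr; apply: eq_bigr => t' _; ring.
rewrite exchange_big; apply: eq_bigr => t _; rewrite exchange_big /=.
rewrite -[in RHS](sum_delta v t) mulr_sumr; apply: eq_bigr => t' _.
by rewrite -mulr_sumr oA; ring.
Qed.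

Definition mxcomp A B : S -> S -> K := fun s t => \sum_r A s r * B r t.

Lemma mxappM A B v : mxapp (mxcomp A B) v =1 mxapp A (mxapp B v).
Proof.
move=> s; rewrite /mxapp /mxcomp.
under eq_bigr do rewrite mulr_suml.
rewrite exchange_big; apply: eq_bigr => r _; rewrite mulr_sumr.
by apply: eq_bigr => t _; rewrite mulrA.
Qed.

Lemma orthogM A B : orthog A -> orthog B -> orthog (mxcomp A B).
Proof.
by move=> oA oB s s'; rewrite -oB; exact: (orthog_dot (B ^~ s) (B ^~ s') oA).
Qed.

Definition idmx : S -> S -> K := fun s t => (s == t)%:R.

Lemma orthog_id : orthog idmx.
Proof.
move=> s s'; rewrite /idmx; under eq_bigr do rewrite (eq_sym _ s).
by rewrite sum_delta.
Qed.

Definition householder w : S -> S -> K :=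
  fun s t => (s == t)%:R - 2 * w s * w t / dot w w.

Lemma householderE w v s :
  mxapp (householder w) v s = v s - 2 * dot w v / dot w w * w s.
Proof.
rewrite /mxapp /householder; under eq_bigr do rewrite mulrBl.
rewrite sumrB sum_delta; congr (_ - _).
rewrite [dot w v]/dot mulr_sumr !mulr_suml; apply: eq_bigr => t _.
ring.
Qed.

Lemma orthog_householder w : dot w w != 0 -> orthog (householder w).
Proof.
move=> w0 s s'.
have -> : (s == s')%:R = mxapp (householder w) (householder w ^~ s') s.
  rewrite householderE /householder.
  have -> : dot w (fun t => (t == s')%:R - 2 * w t * w s' / dot w w) = - w s'.
    rewrite dotC dotBl.
    have -> : dot (fun t => (t == s')%:R) w = w s'.
      by rewrite -[RHS](sum_delta w s'); apply: eq_bigr => t _; rewrite eq_sym.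
    have -> : dot (fun t => 2 * w t * w s' / dot w w) w
       = 2 * w s' / dot w w * dot w w.
      by rewrite -dotZl; apply: eq_dot => // t; ring.
    by field.
  by field.
apply: eq_bigr => t _; congr (_ * _).
by rewrite /householder eq_sym; ring.
Qed.

(* Vectors are moved one at a time: the reflection exchanging the current image
   of [a i] with [b i] fixes the [b j] already reached, because the Gram
   matrices agree. *)
Lemma gram_extension (I : eqType) (r : seq I) (a b : I -> S -> K) :
    {in r &, forall i j, dot (a i) (a j) = dot (b i) (b j)} ->
  exists2 A, orthog A & {in r, forall i, mxapp A (a i) =1 b i}.
Proof.
elim: r => [_|i r IH ab]; first by exists idmx => //; exact: orthog_id.
have [j j' jr j'r|A oA Aab] := IH.
  by apply: ab; rewrite inE ?jr ?j'r orbT.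
pose w s := mxapp A (a i) s - b i s.
have [w0|w0] := eqVneq (dot w w) 0.
  exists A => // j; rewrite inE => /predU1P[->|/Aab//] s.
  by apply/eqP; rewrite -subr_eq0; apply/eqP/(dot_eq0 w0).
exists (mxcomp (householder w) A).
  exact: orthogM (orthog_householder w0) oA.
have ii : dot (a i) (a i) = dot (b i) (b i) by apply: ab; rewrite inE eqxx.
have wE v : dot w v = dot (mxapp A (a i)) v - dot (b i) v by rewrite -dotBl.
have ww : dot w w = 2 * dot w (mxapp A (a i)).
  rewrite !wE ![dot _ w]dotC !wE !orthog_dot // ii (dotC _ (b i)); ring.
move=> j; rewrite inE => /predU1P[-> s|jr s]; rewrite mxappM householderE.
  by rewrite -ww divff // mul1r /w; ring.
have -> : dot w (mxapp A (a j)) = 0.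
  rewrite wE orthog_dot // [dot (b i) _](eq_dot (u' := b i) (v' := b j)) //;
    last exact: Aab.
  by rewrite ab ?inE ?eqxx ?jr ?orbT // subrr.
by rewrite mulr0 !mul0r subr0 Aab.
Qed.

End Gram.

Lemma dot_pair (K : realFieldType) (S T : finType) (u v : S * T -> K) :
  dot u v = \sum_a \sum_b u (a, b) * v (a, b).
Proof.
by rewrite pair_bigA; apply: eq_bigr => -[a b].
Qed.

Section Reach.
Variables n m d : nat.
Notation F := (database n m).
Notation Q := (QReg n m d).

(** Pulling back along [par_query f] is the same as pushing forward, since a query is an involution
    by [par_queryK]. *)
Definition oact (W : finType) (f : F) (v : Q * W -> R) : Q * W -> R :=
  fun s => v (par_query f s.1, s.2).

Definition gram (S : finType) (v : F -> S -> R) (f g : F) : R :=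
  dot (v f) (v g).

(* [K1] is the Gram matrix (over databases) of states prepared with [T] queries
   from states with Gram matrix [K0]; only Gram matrices matter since unitaries
   independent of the database are free. *)
Fixpoint reach (T : nat) (W : finType) (K0 K1 : F -> F -> R) : Prop :=
  match T with
  | 0 => K0 =2 K1
  | T'.+1 => exists v : F -> Q * W -> R,
      reach T' W K0 (gram v) /\ gram (fun f => oact f (v f)) =2 K1
  end.

Lemma xor_bitsK (a b : Bits m) : xor_bits (xor_bits a b) b = a.
Proof. by apply/ffunP => j; rewrite !ffunE; case: (a j) (b j) => [] []. Qed.

Lemma par_queryK f : involutive (@par_query n m d f).
Proof.
by move=> q; apply/ffunP => i; rewrite !ffunE /= xor_bitsK; case: (q i).
Qed.

Lemma reach_eq T W K0 K1 K1' : K1 =2 K1' -> reach T W K0 K1 -> reach T W K0 K1'.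
Proof.
case: T => [|T] e; first by move=> /= h f g; rewrite h e.
by case=> v [h1 h2]; exists v; split=> // f g; rewrite h2 e.
Qed.

Lemma reach_widenl T (W W' : finType) K0 K1 :
  reach T W K0 K1 -> reach T (W + W')%type K0 K1.
Proof.
elim: T K1 => [//|T IH] K1 [v [h1 h2]].
pose v' f (s : Q * (W + W')) := if s.2 is inl w then v f (s.1, w) else 0.
have E (u : F -> Q * W -> R) f g :
    dot (fun s : Q * (W + W') => if s.2 is inl w then u f (s.1, w) else 0)
        (fun s : Q * (W + W') => if s.2 is inl w then u g (s.1, w) else 0)
  = dot (u f) (u g).
  rewrite !dot_pair.
  apply: eq_bigr => q _; rewrite big_sumType /= [X in _ + X]big1 ?addr0 //.
  by move=> w _; rewrite mul0r.
exists v'; split; first by apply/IH/(reach_eq _ h1) => f g; exact: esym (E v f g).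
move=> f g; rewrite -h2 /gram; apply: etrans (E (fun f => oact f (v f)) f g).
by apply: eq_dot => -[q [w|w]].
Qed.

Lemma reach_widenr T (W W' : finType) K0 K1 :
  reach T W K0 K1 -> reach T (W' + W)%type K0 K1.
Proof.
elim: T K1 => [//|T IH] K1 [v [h1 h2]].
pose v' f (s : Q * (W' + W)) := if s.2 is inr w then v f (s.1, w) else 0.
have E (u : F -> Q * W -> R) f g :
    dot (fun s : Q * (W' + W) => if s.2 is inr w then u f (s.1, w) else 0)
        (fun s : Q * (W' + W) => if s.2 is inr w then u g (s.1, w) else 0)
  = dot (u f) (u g).
  rewrite !dot_pair.
  apply: eq_bigr => q _; rewrite big_sumType /= [X in X + _]big1 ?add0r //.
  by move=> w _; rewrite mul0r.
exists v'; split; first by apply/IH/(reach_eq _ h1) => f g; exact: esym (E v f g).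
move=> f g; rewrite -h2 /gram; apply: etrans (E (fun f => oact f (v f)) f g).
by apply: eq_dot => -[q [w|w]].
Qed.

Lemma reach_trans_same T1 T2 W K0 K1 K2 :
  reach T1 W K0 K1 -> reach T2 W K1 K2 -> reach (T1 + T2) W K0 K2.
Proof.
elim: T2 K2 => [|T2 IH] K2 h; first by rewrite addn0 => e; apply: reach_eq h.
by rewrite addnS => -[v [h1 h2]]; exists v; split=> //; apply: IH.
Qed.

Definition reachable T K0 K1 := exists W, reach T W K0 K1.

Lemma reachable_trans T1 T2 K0 K1 K2 :
  reachable T1 K0 K1 -> reachable T2 K1 K2 -> reachable (T1 + T2) K0 K2.
Proof.
move=> [W1 h1] [W2 h2]; exists (W1 + W2)%type.
exact: reach_trans_same (reach_widenl _ h1) (reach_widenr _ h2).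
Qed.

Lemma reachable_eq T K0 K1 K1' :
  K1 =2 K1' -> reachable T K0 K1 -> reachable T K0 K1'.
Proof. by move=> e [W h]; exists W; apply: reach_eq h. Qed.

Lemma reachable0 K0 K1 : K0 =2 K1 -> reachable 0 K0 K1.
Proof. by move=> e; exists unit. Qed.

Fixpoint rrun (W : finType) (f : F) (psi0 : Q * W -> R)
    (U : nat -> Q * W -> Q * W -> R) (t : nat) : Q * W -> R :=
  match t with
  | 0 => mxapp (U 0%N) psi0
  | t'.+1 => mxapp (U t) (oact f (rrun f psi0 U t'))
  end.

Lemma eq_mxapp (S : finType) (A : S -> S -> R) u v :
  u =1 v -> mxapp A u =1 mxapp A v.
Proof. by move=> e s; apply: eq_bigr => t _; rewrite e. Qed.

Lemma eq_rrun (W : finType) f (psi0 : Q * W -> R)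
    (U U' : nat -> Q * W -> Q * W -> R) (T : nat) :
  (forall t : nat, (t <= T)%N -> U t = U' t) ->
  rrun f psi0 U T =1 rrun f psi0 U' T.
Proof.
elim: T => [|T IH] e /=; first by rewrite e.
rewrite e //; apply: eq_mxapp => s; apply: IH => t tT.
by apply: e; rewrite (leq_trans tT).
Qed.

Lemma gram_extension_all (S : finType) (a b : F -> S -> R) :
  gram a =2 gram b ->
  exists2 A, orthog A & forall f, mxapp A (a f) =1 b f.
Proof.
move=> ab; have [f g _ _|A oA Aab] := @gram_extension _ _ _ (enum F) a b; first exact: ab.
by exists A => // f; apply: Aab; rewrite mem_enum.
Qed.

(** Between consecutive queries, equality of the Gram matrices over all databases yields one
    orthogonal map serving every database; these maps are the steps of the algorithm. *)
Lemma reach_run T (W : finType) K0 K1 (psi0 : Q * W -> R) (w : F -> Q * W -> R) :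
  reach T W K0 K1 -> gram (fun=> psi0) =2 K0 -> gram w =2 K1 ->
  exists2 U, forall t, orthog (U t) & forall f, rrun f psi0 U T =1 w f.
Proof.
elim: T K1 w => [|T IH] K1 w /= h h0 h1.
  have e : gram (fun=> psi0) =2 gram w by move=> f g; rewrite h0 h h1.
  by have [A oA Aab] := gram_extension_all e; exists (fun=> A).
have [v [hv1 hv2]] := h; have [U oU hU] := IH _ v hv1 h0 (fun _ _ => erefl).
have e : gram (fun f => oact f (v f)) =2 gram w.
  by move=> f g; rewrite hv2 h1.
have [A oA Aab] := gram_extension_all e.
exists (fun t => if t == T.+1 then A else U t) => [t|f s]; first by case: eqP.
rewrite eqxx -Aab; apply: eq_mxapp => {}s; rewrite /oact -hU.
by apply: eq_rrun => t tT; rewrite ltn_eqF.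
Qed.

End Reach.

(** * From real states and orthogonal maps to complex quantum algorithms *)

Section Complexify.
Variables (n m d : nat) (W : finType).
Notation C := Defs.C.
Notation B := (Basis n m d W).

Definition cvec (S : finType) (v : S -> R) : S -> C := fun s => (v s)%:C%C.

Lemma cvec_apply (S : finType) (A : S -> S -> R) (v : S -> R) (v' : S -> C) :
  v' =1 cvec v ->
  apply_op (fun s t => (A s t)%:C%C) v' =1 cvec (mxapp A v).
Proof.
move=> e s; rewrite /apply_op /cvec /mxapp rmorph_sum /=.
by apply: eq_bigr => t _; rewrite e rmorphM.
Qed.

Lemma cvec_oracle (f : database n m) (v : B -> R) (v' : B -> C) :
  v' =1 cvec v ->
  apply_op (@oracle_op n m d W f) v' =1 cvec (oact f v).
Proof.
move=> e s; rewrite /apply_op /oracle_op.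
rewrite (bigD1 (par_query f s.1, s.2)) //= par_queryK !eqxx mul1r big1.
  by rewrite addr0 e.
move=> t ts; rewrite (_ : _ && _ = false) ?mul0r //.
apply: contraNF ts => /andP[/eqP-> /eqP->]; rewrite par_queryK.
by case: t.
Qed.

Lemma cvec_run (f : database n m) (psi0 : B -> R) U T :
  run_state f (cvec psi0) (fun t s s' => (U t s s')%:C%C) T
  =1 cvec (rrun f psi0 U T).
Proof.
elim: T => [|T IH] /=; first exact: cvec_apply.
by apply: cvec_apply; apply: cvec_oracle.
Qed.

Lemma cvec_dot (S : finType) (u v : S -> R) :
  \sum_s (cvec u s)^* * cvec v s = (dot u v)%:C%C.
Proof.
rewrite /dot rmorph_sum; apply: eq_bigr => s _.
rewrite rmorphM /cvec; congr (_ * _).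
by apply: conj_Creal; apply/complex_realP; exists (u s).
Qed.

Lemma orthog_unitary (S : finType) (A : S -> S -> R) :
  orthog A -> unitary_op (fun s t => (A s t)%:C%C : C).
Proof.
move=> oA s s'; rewrite -(rmorph_nat (real_complex R)) -oA.
exact: (cvec_dot (A^~ s) (A^~ s')).
Qed.

Lemma meas_cvec (S : finType) (psi : S -> C) (v : S -> R) (P : pred S) :
  psi =1 cvec v -> meas_prob psi P = \sum_(s | P s) v s ^+ 2.
Proof.
move=> e; apply: eq_bigr => s _; rewrite e /cvec.
rewrite conj_Creal; first by rewrite -rmorphM /= expr2.
by apply/complex_realP; exists (v s).
Qed.

End Complexify.

Section Solves.
Variables n m d k : nat.
Notation F := (database n m).
Notation Q := (QReg n m d).
Variable y : {ffun 'I_k -> Bits m}.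

Definition promised (f : F) := forall i, exists x, f x = y i.

Lemma three_quarters : (3 / 4)%R = 3 / 4 :> R.
Proof. by rewrite RdivE !IZRposE !INRE. Qed.

Lemma reachable_solves (S : finType) (phi : F -> S -> R)
    (kn : S -> {ffun 'I_k -> Bits n}) T :
  reachable d T (fun _ _ => 1) (gram phi) ->
  (forall f, promised f ->
    3 / 4 <= \sum_(s | [forall i, f (kn s i) == y i]) phi f s ^+ 2) ->
  solves_with_queries n m d k y T.
Proof.
move=> [W0 /(reach_widenl (S + unit)%type) h] good.
set W := (W0 + (S + unit))%type in h.
pose q0 : Q := [ffun=> ([ffun=> false], [ffun=> false])].
pose psi0 (s : Q * W) : R := ((q0, inr (inr tt)) == s)%:R.
pose w f (s : Q * W) := (q0 == s.1)%:R *
  (if s.2 is inr (inl t) then phi f t else 0).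
have [f g|f g|U oU hU] := reach_run (psi0 := psi0) (w := w) h.
- by rewrite /gram /dot sum_delta /psi0 eqxx.
- rewrite /gram dot_pair (bigD1 q0) //= [X in _ + X]big1 ?addr0; last first.
    by move=> q qq0; apply: big1 => x _; rewrite /w eq_sym (negPf qq0) !mul0r.
  rewrite big_sumType /= [X in X + _]big1 ?add0r; last first.
    by move=> x _; rewrite /w mulr0 mul0r.
  rewrite big_sumType /= [X in _ + X]big1 ?addr0; last first.
    by move=> x _; rewrite /w mulr0 mul0r.
  by apply: eq_bigr => t _; rewrite /w eqxx !mul1r.
pose out (s : Q * W) := if s.2 is inr (inl t) then kn t else [ffun=> [ffun=> false]].
exists W, (cvec psi0), (fun t s s' => (U t s s')%:C%C), out; split.
  by rewrite /unit_vector cvec_dot /dot sum_delta /psi0 eqxx.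
split=> [t _|f pf]; first exact: orthog_unitary.
rewrite (meas_cvec (v := w f)); last first.
  by move=> s; rewrite cvec_run /cvec hU.
apply/RleP; rewrite three_quarters; apply: le_trans (good f pf) _.
rewrite [leRHS]big_mkcond -(pair_bigA _ (fun q x =>
   if [forall i, f (out (q, x) i) == y i] then w f (q, x) ^+ 2 else 0)) /=.
rewrite (bigD1 q0) //= big_sumType /= big_sumType /= -!addrA ler_wpDl //.
  by apply: sumr_ge0 => x _; case: ifP => // _; rewrite sqr_ge0.
rewrite [leLHS]big_mkcond /= ler_wpDr //.
  rewrite addr_ge0 // ?sumr_ge0 // => [x _|q _].
    by case: ifP => // _; rewrite sqr_ge0.
  by apply: sumr_ge0 => x _; case: ifP => // _; rewrite sqr_ge0.
by apply: ler_sum => t _; rewrite /w /= eqxx mul1r.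
Qed.

End Solves.

(** * Parallel exact Grover search *)

Section QuerySteps.
Variables (n m d : nat) (S : finType).
Notation F := (database n m).
Notation Q := (QReg n m d).
Variables (phi : F -> S -> R) (q : S -> Q).

(** Lets a query address be written or erased for free, since it does not depend on the database. *)
Lemma gram_tag (T : finType) (u : F -> S -> R) (r : F -> S -> T) f g :
  (forall s, r f s = r g s) ->
  \sum_t \sum_s (u f s * (t == r f s)%:R) * (u g s * (t == r g s)%:R)
  = gram u f g.
Proof.
move=> e; rewrite exchange_big; apply: eq_bigr => s _.
rewrite (bigD1 (r f s)) //= -e eqxx big1 /=; first by ring.
by move=> t /negPf -> /=; ring.
Qed.

Lemma reach_query :
  reachable d 1 (gram phi)
    (gram (fun f (s : S * Q) => phi f s.1 * (s.2 == par_query f (q s.1))%:R)).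
Proof.
exists S, (fun f s => phi f s.2 * (s.1 == q s.2)%:R); split.
  by move=> f g; rewrite [RHS]/gram dot_pair (@gram_tag _ phi (fun=> q)).
move=> f g; rewrite /gram !dot_pair exchange_big /=.
apply: eq_bigr => s _; apply: eq_bigr => r _; rewrite /oact /=.
by rewrite !(can2_eq (@par_queryK _ _ _ _) (@par_queryK _ _ _ _)).
Qed.

(* Compute the answer, apply a phase depending on it, uncompute. *)
Lemma reach_phase (P : S -> Q -> R) :
  (forall s r, P s r * P s r = 1) ->
  reachable d 2 (gram phi) (gram (fun f s => phi f s * P s (par_query f (q s)))).
Proof.
move=> P1; apply: (@reachable_trans _ _ _ 1 1); first exact: reach_query.
exists S, (fun f s => phi f s.2 * P s.2 s.1 * (s.1 == par_query f (q s.2))%:R).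
split.
  move=> f g; rewrite /gram !dot_pair exchange_big; apply: eq_bigr => r _.
  apply: eq_bigr => s _ /=.
  set a := (_ == _)%:R; set b := (_ == _)%:R.
  by transitivity (P s r * P s r * (phi f s * a * (phi g s * b)));
    [rewrite P1 mul1r | ring].
move=> f g; rewrite /gram dot_pair.
apply: etrans (@gram_tag _ (fun f s => phi f s * P s (par_query f (q s)))
  (fun=> q) f g _); last by [].
apply: eq_bigr => r _; apply: eq_bigr => s _; rewrite /oact /=.
rewrite !(inj_eq (can_inj (@par_queryK _ _ _ _))).
by case: eqP => [->|_] //; rewrite !mulr0.
Qed.

End QuerySteps.

Section Block.
Variables (X : finType) (sg : R).
Variable blk : {set X}.
Hypothesis blk_le1 : #|blk|%:R * sg ^+ 2 <= 1.

(** [None] is a dummy item that is never marked. It absorbs the weight outside the block, so that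
    the amplitude [sg] of an address can be tuned freely. *)
Definition start (o : option X) :=
  if o is Some x then sg * (x \in blk)%:R
  else Num.sqrt (1 - #|blk|%:R * sg ^+ 2).

Lemma sum_option (G : option X -> R) : \sum_o G o = G None + \sum_x G (Some x).
Proof.
rewrite (bigD1 None) //=; congr (_ + _).
rewrite (reindex_omap Some (fun o => o)) /=; last by case.
by apply: eq_bigl => x; rewrite eqxx.
Qed.

Lemma start_unit : dot start start = 1.
Proof.
rewrite /dot sum_option /= -expr2 sqr_sqrtr ?subr_ge0 //.
have -> : \sum_x sg * (x \in blk)%:R * (sg * (x \in blk)%:R) = #|blk|%:R * sg ^+ 2.
  rewrite -sumr_const mulr_suml [RHS]big_mkcond; apply: eq_bigr => x _.
  by case: (x \in blk) => /=; ring.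
by rewrite subrK.
Qed.

Definition diffusion (v : option X -> R) : option X -> R :=
  fun o => 2 * dot start v * start o - v o.

Lemma diffusion_dot u v : dot (diffusion u) (diffusion v) = dot u v.
Proof.
have E a b : dot (fun o => 2 * a * start o - u o) (fun o => 2 * b * start o - v o)
  = 4 * a * b * dot start start - 2 * a * dot start v - 2 * b * dot start u + dot u v.
  by rewrite /dot !mulr_sumr -!sumrB -big_split /=; apply: eq_bigr => o _; ring.
by rewrite [LHS]E start_unit; ring.
Qed.

Definition flip (mk : pred X) (v : option X -> R) : option X -> R :=
  fun o => v o * (if o is Some x then (-1) ^+ mk x else 1).

Definition grover (mk : pred X) (t : nat) : option X -> R :=
  iter t (diffusion \o flip mk) start.

Lemma flip_dot mk u : dot (flip mk u) (flip mk u) = dot u u.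
Proof.
apply: eq_bigr => -[x|] _; rewrite /flip ?mulr1 //.
by case: (mk x) => /=; rewrite ?expr1 ?expr0; ring.
Qed.

Lemma grover_unit mk t : dot (grover mk t) (grover mk t) = 1.
Proof.
elim: t => [|t IH]; first exact: start_unit.
by rewrite -IH [in LHS]/grover iterS /= diffusion_dot flip_dot.
Qed.

Definition unique_mark (mk : pred X) (x : X) :=
  [&& x \in blk, mk x & [forall z in blk, mk z ==> (z == x)]].

(* The state stays in the plane spanned by the start vector and the marked
   basis vector. *)
Lemma grover_unique (mk : pred X) x (A B : nat -> R) t :
  unique_mark mk x -> A 0%N = 1 -> B 0%N = 0 ->
  (forall t, A t.+1 = A t * (1 - 4 * sg ^+ 2) - 2 * B t * sg) ->
  (forall t, B t.+1 = B t + 2 * A t * sg) ->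
  grover mk t =1 (fun o => A t * start o + B t * (Some x == o)%:R).
Proof.
move=> /and3P[xb mx /forall_inP uq] A0 B0 AS BS; elim: t => [|t IH] o.
  by rewrite A0 B0 /=; ring.
have E o' : flip mk (grover mk t) o' =
    A t * start o' - (2 * A t * sg + B t) * (Some x == o')%:R.
  rewrite /flip IH; case: o' => [z|]; last by rewrite (_ : _ == _ = false) //=; ring.
  rewrite (inj_eq (@Some_inj _)) /=.
  have [<-|xz] := eqVneq x z; first by rewrite /= xb mx expr1 /=; ring.
  case zb: (z \in blk); last by case: (mk z) => /=; ring.
  have := uq z zb; rewrite eq_sym (negPf xz) implybF => /negPf -> /=.
  by ring.
rewrite /grover iterS /= -/(grover mk t) /diffusion E.
have -> : dot start (flip mk (grover mk t)) =
    A t * (1 - 2 * sg ^+ 2) - B t * sg.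
  transitivity (A t * dot start start - (2 * A t * sg + B t) * start (Some x)).
    rewrite (eq_dot (u' := start) (v' := (fun o => A t * start o -
      (2 * A t * sg + B t) * (Some x == o)%:R))) //.
    rewrite -(sum_delta start (Some x)) /dot !mulr_sumr -sumrB.
    by apply: eq_bigr => o' _; ring.
  by rewrite start_unit /= xb /=; ring.
by rewrite AS BS; ring.
Qed.

End Block.

Section Angle.
Local Open Scope R_scope.

(* With [th = PI / (2 (2 T + 1))] the rotation by [2 th] per iteration reaches
   the marked vector exactly after [T] iterations. *)
Lemma exact_angle (T : nat) : (0 < T)%N ->
  exists sg (A B : nat -> R),
    [/\ A 0%N = 1, B 0%N = 0,
        forall t, A t.+1 = A t * (1 - 4 * (sg * sg)) - 2 * B t * sg,
        forall t, B t.+1 = B t + 2 * A t * sg &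
        [/\ A T = 0, B T = 1 & INR T * INR T * (sg * sg) <= 1]].
Proof.
move=> T0; have T1 : 1 <= INR T by rewrite -INR_1; apply: le_INR; apply/ssrnat.leP.
have PI0 := PI_RGT_0.
set th := PI / (2 * (2 * INR T + 1)).
have th0 : 0 < th by apply: Rdiv_lt_0_compat => //; stdlra.
have thPI : (2 * INR T + 1) * th = PI / 2 by rewrite /th; stdfield; stdlra.
have th2 : th < PI / 2 by rewrite -thPI; stdnra.
set s := sin th; set c := cos th.
have c0 : 0 < c by apply: cos_gt_0; stdlra.
have c2 : c * c = 1 - s * s.
  by have := sin2_cos2 th; rewrite /Rsqr -/s -/c; stdlra.
pose g (t : nat) := (2 * INR t + 1) * th.
have gS t : g t.+1 = g t + 2 * th by rewrite /g S_INR; stdring.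
have cos2 : cos (2 * th) = 1 - 2 * (s * s) by rewrite cos_2a_sin -/s; stdring.
have sin2 : sin (2 * th) = 2 * s * c by rewrite sin_2a.
(* In the orthonormal basis formed by the marked vector and the normalized rest of the start vector,
   the state is [(sin (g t), cos (g t))]. [A] and [B] are its coordinates on the start vector and
   the marked vector, which are not orthogonal. *)
pose A t := cos (g t) / c.
pose B t := sin (g t) - A t * s.
have g0 : g 0%N = th by rewrite /g /=; stdring.
exists s, A, B; split.
- by rewrite /A g0 -/c; stdfield; stdlra.
- by rewrite /B /A g0 -/c -/s; stdfield; stdlra.
- move=> t; rewrite /B /A gS cos_plus cos2 sin2; stdfield; stdlra.
- move=> t; rewrite /B /A gS cos_plus sin_plus cos2 sin2.
  apply: (Rmult_eq_reg_l c); last by stdlra.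
  have -> : c * (sin (g t) * (1 - 2 * (s * s)) + cos (g t) * (2 * s * c) -
     (cos (g t) * (1 - 2 * (s * s)) - sin (g t) * (2 * s * c)) / c * s)
     = c * sin (g t) + cos (g t) * s * (2 * (c * c) - 1 + 2 * (s * s)).
    by stdfield; stdlra.
  by rewrite c2; stdfield; stdlra.
- split.
  + by rewrite /A /g thPI cos_PI2; stdfield; stdlra.
  + by rewrite /B /A /g thPI cos_PI2 sin_PI2; stdfield; stdlra.
  have s0 : 0 < s by apply: sin_gt_0; stdlra.
  have sth : s < th by apply: sin_lt_x.
  have Ts : INR T * s <= 1.
    (* [T th < PI / 4], and [PI <= 4]. *)
    have Tth : INR T * th <= 1 by have hPI := PI_4; stdnra.
    stdnra.
  have Ts0 : 0 <= INR T * s by apply: Rmult_le_pos; stdlra.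
  have -> : INR T * INR T * (s * s) = (INR T * s) * (INR T * s) by stdring.
  stdnra.
Qed.

End Angle.

Section Batch.
Variables (n m d : nat).
Notation F := (database n m).
Notation Q := (QReg n m d).
Notation X := (Bits n).
Variables (S : finType) (phi : F -> S -> R).
Variables (blk : S -> 'I_d -> {set X}) (mk : S -> pred (Bits m)).
Variable (T : nat).
Hypothesis T0 : (0 < T)%N.
Hypothesis blkT : forall s b, (#|blk s b| <= T * T)%N.

Notation J := {ffun 'I_d -> option X}.

(** A processor in the dummy state [None] queries an arbitrary address, and its answer is
    ignored. *)
Let ask (j : J) : Q := [ffun b => (odflt [ffun=> false] (j b), [ffun=> false])].

Lemma par_ask f j b : (par_query f (ask j) b).2 = f (odflt [ffun=> false] (j b)).
Proof. by apply/ffunP => i; rewrite !ffunE /=; case: (f _ _). Qed.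

(** For fixed [s] the processors are in a product state, so their inner product factors. *)
Lemma gram_prod (G : F -> S -> 'I_d -> option X -> R) f g :
  gram (fun f (s : S * J) => phi f s.1 * \prod_b G f s.1 b (s.2 b)) f g =
  \sum_s phi f s * phi g s * \prod_b dot (G f s b) (G g s b).
Proof.
rewrite /gram dot_pair; apply: eq_bigr => s _.
rewrite /dot bigA_distr_bigA mulr_sumr; apply: eq_bigr => j _ /=.
by rewrite big_split /=; ring.
Qed.

Section Run.
Variable sg : R.
Hypothesis sgT : forall s b, #|blk s b|%:R * sg ^+ 2 <= 1.

Definition gstate t f s b := grover sg (blk s b) (fun x => mk s (f x)) t.

Definition psi t f (s : S * J) := phi f s.1 * \prod_b gstate t f s.1 b (s.2 b).

(** An iteration costs two queries, to compute and uncompute the phase; the diffusion does not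
    depend on the database and is invisible to the Gram matrix. *)
Lemma reach_psi t : reachable d (2 * t) (gram phi) (gram (psi t)).
Proof.
elim: t => [|t IH].
  apply: reachable0 => f g; apply: etrans _ (esym (gram_prod (gstate 0) f g)).
  apply: eq_bigr => s _.
  by rewrite big1 ?mulr1 // => b _; rewrite start_unit.
pose P (s : S * J) (r : Q) :=
  \prod_b (if s.2 b is Some x then (-1) ^+ mk s.1 (r b).2 else 1 : R).
have P1 s r : P s r * P s r = 1.
  rewrite /P -big_split big1 //= => b _; case: (s.2 b) => [x|]; last by rewrite mulr1.
  by rewrite -expr2 -exprM mulnC exprM sqrrN !expr1n.
rewrite mulnS addnC; apply: reachable_trans IH _.
have := reach_phase (psi t) (fun s => ask s.2) P1.
apply: reachable_eq => f g.
pose G f s b := flip (fun x => mk s (f x)) (gstate t f s b).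
transitivity (gram (fun f (s : S * J) =>
                 phi f s.1 * \prod_b G f s.1 b (s.2 b)) f g).
  apply: eq_bigr => -[s j] _; congr (_ * _).
    rewrite /psi /P -mulrA -big_split /=; congr (_ * _); apply: eq_bigr => b _.
    by rewrite /G /flip par_ask; case: (j b).
  rewrite /psi /P -mulrA -big_split /=; congr (_ * _); apply: eq_bigr => b _.
  by rewrite /G /flip par_ask; case: (j b).
apply: etrans (gram_prod G f g) _.
apply: etrans _ (esym (gram_prod (gstate t.+1) f g)).
apply: eq_bigr => s _; congr (_ * _).
apply: eq_bigr => b _; rewrite /gstate /grover !iterS /=.
by rewrite diffusion_dot.
Qed.

Lemma gstate_unit t f s : \prod_b dot (gstate t f s b) (gstate t f s b) = 1.
Proof. by rewrite big1 // => b _; rewrite grover_unit. Qed.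

End Run.

(* One parallel batch: processor [b] searches [blk s b] for a marked address,
   with outcome [j s' b], and reads the database there, with answer [a s' b]. *)
Lemma batch :
  exists (S' : finType) (phi' : F -> S' -> R) (p : S' -> S) (j : S' -> J)
         (a : S' -> {ffun 'I_d -> Bits m}),
  [/\ reachable d (2 * T).+1 (gram phi) (gram phi'),
      forall f s, \sum_(s' | p s' == s) phi' f s' ^+ 2 = phi f s ^+ 2 &
      forall f s', phi' f s' != 0 ->
        [/\ phi f (p s') != 0,
            forall b x, j s' b = Some x -> a s' b = f x &
            forall b x, unique_mark (blk (p s') b) (fun x => mk (p s') (f x)) x ->
              j s' b = Some x]].
Proof.
have [sg [A [B [A0 B0 AS BS [AT BT sgT']]]]] := exact_angle T0.
have sgT s b : #|blk s b|%:R * sg ^+ 2 <= 1.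
  apply: le_trans (_ : (T * T)%:R * sg ^+ 2 <= 1).
    by rewrite ler_wpM2r ?sqr_ge0 // ler_nat.
  by move/RleP: sgT'; rewrite !RealsE /= natrM expr2.
have AS' t : A t.+1 = A t * (1 - 4 * sg ^+ 2) - 2 * B t * sg.
  by rewrite AS !RealsE /= expr2.
have BS' t : B t.+1 = B t + 2 * A t * sg by rewrite BS !RealsE.
pose psiT := psi sg T.
exists (S * J * Q)%type.
exists (fun f s' => psiT f s'.1 * (s'.2 == par_query f (ask s'.1.2))%:R).
exists (fun s' => s'.1.1), (fun s' => s'.1.2), (fun s' : S * J * Q => [ffun b => (s'.2 b).2]).
split.
- rewrite -addn1; apply: reachable_trans (reach_psi sgT T) _.
  exact: (reach_query psiT (fun s : S * J => ask s.2)).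
- move=> f s.
  rewrite big_mkcond /= -(pair_bigA _ (fun (t : S * J) (r : Q) => if t.1 == s
    then (psiT f t * (r == par_query f (ask t.2))%:R) ^+ 2 else 0)) /=.
  rewrite -(pair_bigA _ (fun (t : S) (j : J) => \sum_r (if t == s then
    (psiT f (t, j) * (r == par_query f (ask j))%:R) ^+ 2 else 0))) /=.
  rewrite (bigD1 s) //= [X in _ + X]big1 ?addr0; last first.
    by move=> t /negPf ->; apply: big1 => j _; apply: big1.
  rewrite eqxx -[RHS]mulr1 -[X in _ = _ * X](gstate_unit sgT T f s) bigA_distr_bigA mulr_sumr.
  apply: eq_bigr => j _.
  rewrite (bigD1 (par_query f (ask j))) //= eqxx [X in _ + X]big1 ?addr0.
    rewrite big_split /= /psiT /psi /=; ring.
  by move=> r /negPf -> /=; ring.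
move=> f [[s j] r] /= h.
have -> : r = par_query f (ask j).
  by apply/eqP; apply: contraNT h => /negPf ->; rewrite mulr0.
have : psiT f (s, j) != 0 by apply: contraNneq h => ->; rewrite mul0r.
rewrite /psiT /psi mulf_eq0 negb_or /= => /andP[-> /prodf_neq0 g0].
split=> // b x; first by rewrite ffunE par_ask => ->.
(* Since [A T = 0] and [B T = 1], this processor is exactly in the marked basis state, and a nonzero
   amplitude forces its outcome. *)
move=> ux; have := g0 b isT; rewrite /gstate.
rewrite (@grover_unique _ _ _ (sgT s b) _ _ _ _ _ ux A0 B0 AS' BS').
rewrite [A T]AT [B T]BT !RealsE /= mul0r add0r mul1r.
by case: (Some x =P j b) => [<- //|_]; rewrite eqxx.
Qed.

End Batch.

(** * Adaptive schedules of parallel searches *)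

Section Schedule.
Variables (n m d k : nat) (y : {ffun 'I_k -> Bits m}).
Notation F := (database n m).
Notation X := (Bits n).

Definition wanted (A : {set 'I_k}) (v : Bits m) := [exists i in A, v == y i].

(* An item counts as located only if one of its preimages is the unique wanted
   address of its block, where the exact search is certain to succeed. *)
Definition missed (f : F) (A : {set 'I_k}) (blk : 'I_d -> {set X}) : {set 'I_k} :=
  [set i in A | ~~ [exists b, exists x,
     unique_mark (blk b) (fun z => wanted A (f z)) x && (f x == y i)]].

Variable Om : finType.

(** An entry is one batch: a number of Grover iterations and, for each random choice, the block of
    every processor. *)
Definition schedule := seq (nat * (Om -> 'I_d -> {set X})).

Fixpoint valid (sc : schedule) : Prop :=
  if sc is e :: sc' then
    [/\ (0 < e.1)%N, forall w b, (#|e.2 w b| <= e.1 * e.1)%N & valid sc']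
  else True.

Definition cost (sc : schedule) : nat := sumn [seq (2 * e.1).+1 | e <- sc].

Definition left_after (f : F) (w : Om) (A : {set 'I_k}) (sc : schedule) :=
  foldl (fun B e => missed f B (e.2 w)) A sc.

(** The random choice [om] is kept as a uniformly distributed register. The bound [U] on the unfound
    items depends only on the database and that choice, not on search outcomes. *)
Definition tracks (S : finType) (phi : F -> S -> R) (om : S -> Om)
    (kn : S -> {ffun 'I_k -> option X}) (U : F -> Om -> {set 'I_k}) :=
  (forall f s, phi f s != 0 ->
     (forall i x, kn s i = Some x -> f x = y i) /\
     (forall i, kn s i = None -> i \in U f (om s))) /\
  (forall f w, \sum_(s | om s == w) phi f s ^+ 2 = #|Om|%:R^-1).

Lemma wantedS (A B : {set 'I_k}) v : A \subset B -> wanted A v -> wanted B v.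
Proof.
move=> /subsetP AB /exists_inP[i /AB iB vi].
by apply/exists_inP; exists i.
Qed.

(** Fewer unfound items mean fewer marks. Hence an item found by luck never spoils a search that was
    certain to succeed for the larger set [B]. *)
Lemma unique_markS (A B : {set 'I_k}) (f : F) (D : {set X}) x i :
  A \subset B -> i \in A -> f x = y i ->
  unique_mark D (fun z => wanted B (f z)) x ->
  unique_mark D (fun z => wanted A (f z)) x.
Proof.
move=> AB iA fx /and3P[xD _ /forall_inP uq]; apply/and3P; split=> //.
  by apply/exists_inP; exists i; rewrite ?fx.
apply/forall_inP => z zD; apply/implyP => /(wantedS AB) zB.
exact: implyP (uq z zD) zB.
Qed.

Lemma batch_tracks (S : finType) (phi : F -> S -> R) om kn U T
    (blk : Om -> 'I_d -> {set X}) :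
  @tracks S phi om kn U ->
  (0 < T)%N -> (forall w b, (#|blk w b| <= T * T)%N) ->
  exists (S' : finType) (phi' : F -> S' -> R) om' kn',
    reachable d (2 * T).+1 (gram phi) (gram phi') /\
    @tracks S' phi' om' kn' (fun f w => missed f (U f w) (blk w)).
Proof.
move=> [inv marg] T0 blkT.
(* The marks used are those of the items actually unfound in [s], possibly fewer than the bound
   [U]. *)
pose Un s := [set i | kn s i == None].
have [S' [phi' [p [j [a [rch marg' supp]]]]]] :=
  batch phi (blk := fun s => blk (om s)) (fun s => wanted (Un s)) T0
    (fun s b => blkT (om s) b).
pose kn' s' : {ffun 'I_k -> option X} := [ffun i =>
  if kn (p s') i is Some x then Some x
  else [pick x | [exists b, (j s' b == Some x) && (a s' b == y i)]]].
exists S', phi', (fun s' => om (p s')), kn'; split=> //; split; last first.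
  move=> f w; rewrite -(marg f w).
  rewrite (partition_big p (fun s => om s == w)) //=.
  apply: eq_bigr => s /eqP osw; rewrite -marg'; apply: eq_bigl => s'.
  by case: (p s' =P s) => [->|]; rewrite ?osw ?eqxx ?andbF.
move=> f s' nz; have [nz0 aE uE] := supp f s' nz.
have [snd unf] := inv f _ nz0; split=> i => [x|].
  rewrite ffunE; case Ek: (kn (p s') i) => [z|].
    by move=> [<-]; exact: snd.
  case: pickP => // z /existsP[b /andP[/eqP jb /eqP ab]] [<-].
  by rewrite -(aE b z jb).
rewrite ffunE; case Ek: (kn (p s') i) => [//|].
case: pickP => // none _; rewrite inE unf //=.
apply/negP => /existsP[b /existsP[x /andP[uq /eqP fx]]].
have iUn : i \in Un (p s') by rewrite inE Ek.
have sub : Un (p s') \subset U f (om (p s')).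
  by apply/subsetP => i'; rewrite inE => /eqP; exact: unf.
have jb := uE b x (unique_markS sub iUn fx uq).
have /negP[] := negbT (none x); apply/existsP; exists b.
by rewrite jb (aE b x jb) fx !eqxx.
Qed.

Lemma schedule_tracks sc (S : finType) (phi : F -> S -> R) om kn U :
  @tracks S phi om kn U -> valid sc ->
  exists (S' : finType) (phi' : F -> S' -> R) om' kn',
    reachable d (cost sc) (gram phi) (gram phi') /\
    @tracks S' phi' om' kn' (fun f w => left_after f w (U f w) sc).
Proof.
elim: sc S phi om kn U => [|[T blk] sc IH] S phi om kn U tr /=.
  by exists S, phi, om, kn; split=> //; exact: reachable0.
move=> [T0 blkT vsc].
have [S1 [phi1 [om1 [kn1 [r1 tr1]]]]] := batch_tracks tr T0 blkT.
have [S2 [phi2 [om2 [kn2 [r2 tr2]]]]] := IH _ _ _ _ _ tr1 vsc.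
exists S2, phi2, om2, kn2; split=> //.
exact: reachable_trans r1 r2.
Qed.

Lemma schedule_solves sc : valid sc -> (0 < #|Om|)%N ->
  (forall f, promised y f ->
     3 / 4 * (#|Om|%:R : R) <= #|[set w | left_after f w setT sc == set0]|%:R) ->
  solves_with_queries n m d k y (cost sc).
Proof.
move=> vsc Om0 good.
(* The random choice starts as a uniform superposition, the same for all databases, so its Gram
   matrix is constantly 1. *)
have Om0' : 0 < #|Om|%:R :> R by rewrite ltr0n.
pose phi (f : F) (w : Om) : R := Num.sqrt (#|Om|%:R^-1).
have phi2 f w : phi f w ^+ 2 = #|Om|%:R^-1.
  by rewrite sqr_sqrtr // invr_ge0 ltW.
pose kn (w : Om) : {ffun 'I_k -> option X} := [ffun=> None].
have tr : @tracks Om phi (fun w => w) kn (fun _ _ => setT).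
  split=> [f s _|f w].
    by split=> i => [x|]; rewrite ffunE // inE.
  by rewrite big_pred1_eq phi2.
have [S1 [phi1 [om1 [kn1 [r1 [inv marg]]]]]] := schedule_tracks tr vsc.
apply: (@reachable_solves _ _ _ _ _ S1 phi1
  (fun s => [ffun i => odflt [ffun=> false] (kn1 s i)])).
  case: r1 => W /= r1; exists W; move: r1.
  have e : gram phi =2 (fun _ _ => 1).
    move=> f g; rewrite /gram /dot; under eq_bigr do rewrite -expr2 phi2.
    by rewrite sumr_const -[_ *+ _]mulr_natr mulVf // gt_eqF.
  elim: (cost sc) (gram phi1) => [|t IH] K1 /=; first by move=> h f g; rewrite -h e.
  by move=> [v [/IH h1 h2]]; exists v.
move=> f pf; pose G (f : F) := [set w | left_after f w setT sc == set0].
apply: (@le_trans _ _ (#|G f|%:R * #|Om|%:R^-1)).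
  by rewrite ler_pdivlMr //; exact: good.
rewrite -sumr_const mulr_suml.
under eq_bigr => w _ do rewrite mul1r -(marg f w).
rewrite (_ : \sum_(w in _) _ = \sum_(s | om1 s \in G f) phi1 f s ^+ 2); last first.
  rewrite [RHS](partition_big om1 (mem (G f))) //=; apply: eq_bigr => w wG.
  by apply: eq_bigl => s; case: (om1 s =P w) => [->|]; rewrite ?wG ?andbF.
rewrite big_mkcond [leRHS]big_mkcond; apply: ler_sum => s _.
case: ifP => [sG|_]; last by case: ifP; rewrite // sqr_ge0.
case: ifPn => //; rewrite negb_forall; case/existsP=> i; rewrite ffunE => bad.
have [->|nz] := eqVneq (phi1 f s) 0; first by rewrite expr0n.
have [snd unf] := inv f s nz; move: bad.
case Ek: (kn1 s i) => [x|]; first by rewrite (snd i x Ek) eqxx.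
move: sG (unf i Ek); rewrite inE => /eqP ->.
by rewrite inE.
Qed.

End Schedule.

(** * Random samples cut into blocks *)

Section RandomPermutation.
Variables (K : realFieldType) (X : finType).
Notation N := #|X|.
Notation Om := {perm X}.

Lemma sum_perm_mul (rho : {perm X}) (G : {perm X} -> K) :
  \sum_s G (rho * s)%g = \sum_s G s.
Proof. by rewrite [RHS](reindex_inj (mulgI rho)). Qed.

(** Left translation by [tperm x z] shows that the sum over [s] is the same for all points. Summed
    over the points, each [s] merely reindexes [X]. *)
Lemma perm_avg1 (H : X -> K) x :
  N%:R * \sum_(s : Om) H (s x) = #|Om|%:R * \sum_a H a.
Proof.
transitivity (\sum_(z : X) \sum_(s : Om) H (s z)).
  rewrite mulr_natl -sumr_const; apply: eq_bigr => z _.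
  by rewrite -(sum_perm_mul (tperm x z)); apply: eq_bigr => s _; rewrite permM tpermL.
rewrite exchange_big mulr_natl -sumr_const; apply: eq_big => [s|s _].
  by rewrite inE.
by rewrite [RHS](reindex_inj (@perm_inj _ s)).
Qed.

Lemma perm_avg2 (H : X -> X -> K) x z : x != z ->
  (N * N.-1)%:R * \sum_(s : Om) H (s x) (s z)
  = #|Om|%:R * \sum_a \sum_(b | b != a) H a b.
Proof.
move=> xz.
transitivity (\sum_(x' : X) \sum_(z' | z' != x') \sum_(s : Om) H (s x') (s z')).
  rewrite natrM -mulrA mulr_natl -sumr_const; apply: eq_bigr => x' _.
  rewrite mulr_natl -(cardC1 x') -sumr_const.
  apply: eq_big => [z'|z' /= zx']; first by rewrite inE.
  pose r1 := tperm x x'.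
  (* [rho] sends [x] to [x'] and [z] to [z'], so all ordered pairs of distinct points have the same
     average. *)
  pose rho := (r1 * tperm (r1 z) z')%g.
  rewrite -(sum_perm_mul rho); apply: eq_bigr => s _.
  have z1 : r1 z != x' by rewrite -(tpermL x x') (inj_eq perm_inj) eq_sym.
  by rewrite !permM [r1 x]tpermL tpermL tpermD // eq_sym.
under eq_bigr do rewrite exchange_big /=.
rewrite exchange_big mulr_natl -sumr_const; apply: eq_big => [s|s _].
  by rewrite inE.
rewrite [RHS](reindex_inj (@perm_inj _ s)); apply: eq_bigr => x' _.
rewrite [RHS](reindex_inj (@perm_inj _ s)); apply: eq_bigl => z'.
by rewrite (inj_eq perm_inj).
Qed.

Variables (dom : pred X) (bl : X -> nat) (l : nat).
Hypothesis bl_small : forall a, dom a -> (#|[pred b | bl b == bl a]| <= l)%N.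
Hypothesis N2 : (1 < N)%N.
Notation M := #|dom|.
Hypothesis M0 : (0 < M)%N.

Definition lonely (G : {set X}) (s : Om) x :=
  dom (s x) && [forall z in G, (bl (s z) == bl (s x)) ==> (z == x)].

Lemma l_gt0 : (0 < l)%N.
Proof.
have /card_gt0P[a da] := M0; apply: leq_trans (bl_small da).
by apply/card_gt0P; exists a; rewrite inE.
Qed.

Let hits (S : {set X}) (s : Om) : K := \sum_(x in S) (dom (s x))%:R.

Let clashes (S G : {set X}) (s : Om) : K :=
  \sum_(x in S) \sum_(z in G | z != x) (dom (s x) && (bl (s z) == bl (s x)))%:R.

Let pN : 0 < N%:R :> K. Proof. by rewrite ltr0n ltnW. Qed.
Let pN1 : 0 < N.-1%:R :> K. Proof. by rewrite ltr0n -ltnS prednK // ltnW. Qed.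
Let pM : 0 < M%:R :> K. Proof. by rewrite ltr0n. Qed.
Let leMN : M%:R <= N%:R :> K. Proof. by rewrite ler_nat max_card. Qed.
Let pOm : 0 < #|Om|%:R :> K.
Proof. by rewrite ltr0n; apply/card_gt0P; exists 1%g; rewrite inE. Qed.

Lemma sum_dom : \sum_a (dom a)%:R = M%:R :> K.
Proof.
rewrite -sum1_card natr_sum [RHS]big_mkcond; apply: eq_bigr => a _.
by rewrite unfold_in; case: (dom a).
Qed.

Lemma avg_dom x : \sum_(s : Om) (dom (s x))%:R = #|Om|%:R * (M%:R / N%:R) :> K.
Proof.
have := perm_avg1 (fun a => (dom a)%:R) x; rewrite sum_dom => h.
by rewrite mulrA -h mulrAC mulfV ?mul1r // gt_eqF.
Qed.

(** Sampling without replacement is negatively correlated: [(M - 1) / (N - 1) <= M / N]. *)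
Lemma avg_dom2 x z : x != z ->
  \sum_(s : Om) (dom (s x))%:R * (dom (s z))%:R
  <= #|Om|%:R * (M%:R / N%:R) ^+ 2 :> K.
Proof.
move=> xz.
have := perm_avg2 (fun a b => (dom a)%:R * (dom b)%:R) xz.
have -> : \sum_a \sum_(b | b != a) (dom a)%:R * (dom b)%:R = M%:R * M.-1%:R :> K.
  transitivity (\sum_a (dom a)%:R * M.-1%:R : K); last by rewrite -mulr_suml sum_dom.
  apply: eq_bigr => a _; rewrite -mulr_sumr; case da: (dom a); last by rewrite !mul0r.
  congr (_ * _); apply: (addrI 1).
  have := sum_dom; rewrite (bigD1 a) //= da => ->.
  by rewrite addrC natr1 prednK.
rewrite natrM => h.
have -> : \sum_(s : Om) (dom (s x))%:R * (dom (s z))%:R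
   = #|Om|%:R * (M%:R * M.-1%:R) / (N%:R * N.-1%:R) :> K.
  by rewrite -h mulrAC mulfV ?mul1r // mulf_neq0 ?gt_eqF.
rewrite -mulrA ler_wpM2l ?ler0n // expr2 -mulf_div ler_wpM2l ?divr_ge0 ?ler0n //.
rewrite ler_pdivrMr // mulrAC ler_pdivlMr //.
have eN : N%:R = N.-1%:R + 1 :> K by rewrite natr1 prednK // ltnW.
have eM : M%:R = M.-1%:R + 1 :> K by rewrite natr1 prednK.
have le := leMN; rewrite eN eM in le *.
by nra.
Qed.

(** Once [x] is placed, [z] is uniform on the [N - 1] other places, at most [l - 1] of which lie in
    the block of [x]. *)
Lemma avg_clash x z : z != x ->
  \sum_(s : Om) (dom (s x) && (bl (s z) == bl (s x)))%:R
  <= #|Om|%:R * (M%:R / N%:R) * (l.-1%:R / N.-1%:R) :> K.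
Proof.
rewrite eq_sym => xz.
have := perm_avg2 (fun a b => (dom a && (bl b == bl a))%:R) xz.
have : \sum_a \sum_(b | b != a) (dom a && (bl b == bl a))%:R <= M%:R * l.-1%:R :> K.
  rewrite -sum_dom mulr_suml; apply: ler_sum => a _.
  case da: (dom a) => /=; last by rewrite mul0r big1.
  rewrite mul1r -natr_sum ler_nat -ltnS prednK ?l_gt0 //.
  apply: leq_trans (bl_small da); rewrite -[in leqRHS]sum1_card.
  rewrite [leqRHS](bigD1 a) ?inE //= add1n ltnS.
  rewrite [leqRHS]big_mkcondl big_mkcond /= [leqRHS]big_mkcond.
  by apply: leq_sum => b _; rewrite inE; case: (b != a) => //; case: (_ == _).
rewrite natrM => le h.
rewrite -(ler_pM2l (x := N%:R * N.-1%:R)) ?mulr_gt0 // h.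
have -> : N%:R * N.-1%:R * (#|Om|%:R * (M%:R / N%:R) * (l.-1%:R / N.-1%:R))
  = #|Om|%:R * (M%:R * l.-1%:R) :> K.
  by field; rewrite !gt_eqF.
by rewrite ler_pM2l.
Qed.

Lemma avg_hits (S : {set X}) : \sum_s hits S s = #|Om|%:R * (#|S|%:R * (M%:R / N%:R)).
Proof.
rewrite /hits exchange_big /=; under eq_bigr do rewrite avg_dom.
by rewrite sumr_const -[LHS]mulr_natl; ring.
Qed.

(** The diagonal contributes [mu], and the pairs of distinct points at most [mu ^ 2]. *)
Lemma avg_hits2 (S : {set X}) (mu := #|S|%:R * (M%:R / N%:R) : K) :
  \sum_s hits S s ^+ 2 <= #|Om|%:R * (mu + mu ^+ 2).
Proof.
pose p : K := M%:R / N%:R.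
apply: (@le_trans _ _ (\sum_(x in S) \sum_(z in S)
    (#|Om|%:R * ((x == z)%:R * p + p ^+ 2)))).
  rewrite /hits; under eq_bigr do rewrite expr2 mulr_suml.
  rewrite exchange_big; apply: ler_sum => x _.
  under eq_bigr do rewrite mulr_sumr.
  rewrite exchange_big; apply: ler_sum => z _ /=.
  have [->|xz] := eqVneq x z.
    rewrite mul1r mulrDr -/p; apply: ler_wpDr.
      by rewrite mulr_ge0 ?sqr_ge0.
    rewrite -(avg_dom z); apply: ler_sum => s _.
    by case: (dom _); rewrite ?mul1r ?mul0r.
  by rewrite mul0r add0r; exact: avg_dom2.
rewrite (eq_bigr (fun x => #|Om|%:R * (p + #|S|%:R * p ^+ 2))); last first.
  move=> x xS; rewrite -mulr_sumr big_split /= sumr_const; congr (_ * (_ + _)).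
    rewrite (bigD1 x) //= eqxx mul1r big1 ?addr0 // => z /andP[_ /negPf zx].
    by rewrite eq_sym zx mul0r.
  by rewrite -[LHS]mulr_natl.
rewrite sumr_const -[leLHS]mulr_natl /mu -/p le_eqVlt; apply/orP; left.
by apply/eqP; ring.
Qed.

(* The variance vanishes when the sample is everything. *)
Lemma avg_hits_var (S : {set X}) (mu := #|S|%:R * (M%:R / N%:R) : K) :
  \sum_s (hits S s - mu) ^+ 2 <= #|Om|%:R * ((M < N)%:R * mu).
Proof.
have mu0 : 0 <= mu by rewrite mulr_ge0 ?divr_ge0 ?ler0n.
case: ltnP => [MN|NM] /=.
  rewrite mul1r.
  have -> : \sum_s (hits S s - mu) ^+ 2 =
      \sum_s hits S s ^+ 2 - 2 * mu * \sum_s hits S s + #|Om|%:R * mu ^+ 2.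
    have -> : #|Om|%:R * mu ^+ 2 = \sum_(s : Om) mu ^+ 2.
      by rewrite sumr_const mulr_natl.
    by rewrite mulr_sumr -sumrB -big_split; apply: eq_bigr => s _ /=; ring.
  have h : \sum_s hits S s ^+ 2 <= #|Om|%:R * (mu + mu ^+ 2) := avg_hits2 S.
  by rewrite avg_hits -/mu; lra.
rewrite mul0r mulr0 big1 // => s _.
have MN : M = N by apply/eqP; rewrite eqn_leq max_card.
have domT a : dom a.
  have [_ e] := subset_leqif_card (subset_predT dom).
  by move: e; rewrite MN eqxx => /esym/subsetP/(_ a isT).
rewrite /hits /mu MN divff ?gt_eqF // mulr1 (eq_bigr (fun=> 1)).
  by rewrite sumr_const subrr expr0n.
by move=> x _; rewrite domT.
Qed.

Lemma avg_clashes (S G : {set X}) :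
  \sum_s clashes S G s
  <= #|Om|%:R * ((#|S|%:R * (M%:R / N%:R)) * (#|G|%:R * (l.-1%:R / N.-1%:R))).
Proof.
pose q : K := (M%:R / N%:R) * (l.-1%:R / N.-1%:R).
have q0 : 0 <= q by rewrite !mulr_ge0 ?invr_ge0 ?ler0n.
rewrite /clashes exchange_big /=.
apply: (@le_trans _ _ (\sum_(x in S) \sum_(z in G) #|Om|%:R * q)).
  apply: ler_sum => x _; rewrite exchange_big /= [leLHS]big_mkcondr /=.
  apply: ler_sum => z _; case: ifP => zx; last by rewrite mulr_ge0.
  by have := avg_clash zx; rewrite -mulrA.
rewrite (eq_bigr (fun=> #|G|%:R * (#|Om|%:R * q))); last first.
  by move=> x _; rewrite sumr_const -[LHS]mulr_natl.
rewrite sumr_const -[leLHS]mulr_natl /q le_eqVlt; apply/orP; left.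
by apply/eqP; ring.
Qed.

(** Each sampled point of [S] that is not lonely shares its block with another point of [G], so it
    pays for its own hit. *)
Lemma no_lonely_clash (S G : {set X}) s :
  (forall x, x \in S -> ~~ lonely G s x) -> hits S s <= clashes S G s.
Proof.
move=> no; apply: ler_sum => x xS; case dx: (dom (s x)) => /=; last first.
  by rewrite big1.
move: (no x xS); rewrite /lonely dx /= negb_forall => /existsP[z].
rewrite negb_imply => /andP[zG]; rewrite negb_imply => /andP[bz zx].
by rewrite (bigD1 z) ?zG //= bz ler_wpDr // sumr_ge0.
Qed.

(** Chebyshev's inequality for the hits and Markov's for the clashes, both at [mu / 2]. As the
    variance is at most [mu], the first gives [4 / mu], and [#|S| / mu = N / M] no longer depends on
    the number of preimages. *)
Lemma survive (S G : {set X}) : (0 < #|S|)%N ->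
  #|S|%:R * #|[set s : Om | [forall x in S, ~~ lonely G s x]]|%:R
  <= #|Om|%:R * (4 * (M < N)%:R * (N%:R / M%:R)
                 + 2 * #|S|%:R * #|G|%:R * (l.-1%:R / N.-1%:R)) :> K.
Proof.
move=> S0; have pS : 0 < #|S|%:R :> K by rewrite ltr0n.
pose mu : K := #|S|%:R * (M%:R / N%:R).
have mu0 : 0 < mu by rewrite !mulr_gt0 ?invr_gt0.
(* Without lonely point, [hits <= clashes], so one of the two is far from what
   is expected. *)
have key : #|[set s : Om | [forall x in S, ~~ lonely G s x]]|%:R <=
   \sum_(s : Om) (4 / mu ^+ 2 * (hits S s - mu) ^+ 2 + 2 / mu * clashes S G s).
  rewrite -sum1_card natr_sum big_mkcond; apply: ler_sum => s _.
  have cl0 : 0 <= clashes S G s by do 2 apply: sumr_ge0 => ? _.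
  have t1 : 0 <= 4 / mu ^+ 2 * (hits S s - mu) ^+ 2.
    by rewrite mulr_ge0 ?sqr_ge0 // divr_ge0 ?sqr_ge0.
  have t2 : 0 <= 2 / mu * clashes S G s by rewrite mulr_ge0 // divr_ge0 // ltW.
  rewrite inE; case: ifP => [/forall_inP no|_]; last by rewrite addr_ge0.
  have hc := no_lonely_clash no.
  have [big|small] := leP (mu / 2) (clashes S G s).
    apply: ler_wpDl => //.
    by rewrite mulrAC ler_pdivlMr // mul1r; lra.
  apply: ler_wpDr => //.
  rewrite mulrAC ler_pdivlMr ?exprn_gt0 // mul1r.
  by nra.
apply: (le_trans (ler_wpM2l (ler0n _ _) key)).
rewrite big_split /= -!mulr_sumr.
have h1 : \sum_s (hits S s - mu) ^+ 2 <= #|Om|%:R * ((M < N)%:R * mu) :=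
  avg_hits_var S.
have h2 := avg_clashes S G; rewrite -/mu in h2.
apply: (@le_trans _ _ (#|S|%:R * (4 / mu ^+ 2 * (#|Om|%:R * ((M < N)%:R * mu)) +
   2 / mu * (#|Om|%:R * (mu * (#|G|%:R * (l.-1%:R / N.-1%:R))))))).
  rewrite ler_wpM2l ?ler0n // lerD // ler_wpM2l // ?divr_ge0 ?sqr_ge0 // ltW //.
rewrite le_eqVlt; apply/orP; left; apply/eqP.
rewrite /mu; field.
by rewrite !gt_eqF.
Qed.

End RandomPermutation.

Section Rank.
Variable X : finType.

Definition rank_block (l : nat) (a : X) : nat := (enum_rank a %/ l)%N.

Lemma card_rank_lt (c : nat) :
  #|[pred x : X | (enum_rank x < c)%N]| = minn #|X| c.
Proof.
rewrite -[LHS]sum1_card (reindex (@enum_val X xpredT)) /=; last first.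
  by apply: onW_bij; exact: enum_val_bij.
rewrite (eq_bigl (fun i : 'I_#|X| => (i < c)%N)); last first.
  by move=> i; rewrite inE enum_valK.
have [cX|Xc] := leqP c #|X|.
  by rewrite -(big_ord_widen _ (fun=> 1%N)) // sum1_card card_ord.
rewrite (eq_bigl xpredT) => [|i]; last by rewrite (ltn_trans (ltn_ord i)).
by rewrite sum1_card card_ord.
Qed.

Lemma card_rank_block l c : (0 < l)%N ->
  (#|[pred x : X | rank_block l x == c]| <= l)%N.
Proof.
move=> l0; rewrite -[leqRHS]card_ord.
apply: (@leq_card_in _ _ (fun x => Ordinal (ltn_pmod (enum_rank x) l0))).
move=> x z; rewrite !inE => /eqP xc /eqP zc [xz].
apply: enum_rank_inj; apply: val_inj => /=.
by rewrite (divn_eq (enum_rank x) l) (divn_eq (enum_rank z) l) xz -!/(rank_block l _) xc zc.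
Qed.

End Rank.

(** * One round: searching a random sample block by block *)

Section Round.
Variables (n m d k : nat) (y : {ffun 'I_k -> Bits m}).
Hypotheses (n0 : (0 < n)%N) (d0 : (0 < d)%N) (yI : injective y).
Notation F := (database n m).
Notation X := (Bits n).
Notation Om := {perm Bits n}.

Lemma card_Bits : #|X| = expn 2 n.
Proof. by rewrite card_ffun card_bool card_ord. Qed.

Definition wset (f : F) (A : {set 'I_k}) : {set X} := [set x | wanted y A (f x)].

Definition fiber (f : F) (i : 'I_k) : {set X} := [set x | f x == y i].

(** The fibers are disjoint because [y] is injective. *)
Lemma card_wset f A : #|wset f A| = \sum_(i in A) #|fiber f i|.
Proof.
under eq_bigr do rewrite -sum1_card.
rewrite (exchange_big_dep (mem (wset f A))) /=; last first.
  by move=> i x iA; rewrite !inE => fx; apply/exists_inP; exists i.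
rewrite -sum1_card; apply: eq_bigr => x; rewrite inE => /exists_inP[i iA /eqP fx].
rewrite (bigD1 i) /=; last by rewrite iA inE fx eqxx.
rewrite big1 // => j /andP[/andP[_]]; rewrite inE fx => /eqP /yI ->.
by rewrite eqxx.
Qed.

Variables (Q T : nat).
Hypotheses (Q0 : (0 < Q)%N) (T0 : (0 < T)%N).
Notation l := (T * T)%N.

(** Batch [t] takes the blocks [t d] to [t d + d - 1], so the round covers the first [Q d] blocks of
    the permuted addresses. *)
Definition round : schedule n d Om :=
  [seq (T, fun (s : Om) (b : 'I_d) =>
     [set x | rank_block l (s x) == (t * d + b)%N]) | t <- iota 0 Q].

Lemma round_valid : valid round.
Proof.
rewrite /round; elim: (iota 0 Q) => //= t ts IH; split=> // s b.
have l0 : (0 < l)%N by rewrite muln_gt0 T0.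
apply: leq_trans (card_rank_block X (t * d + b) l0).
rewrite -(card_imset _ (@perm_inj _ s)); apply/subset_leq_card/subsetP => z /imsetP[x].
by rewrite inE => xb ->; rewrite inE.
Qed.

Lemma round_cost : cost round = (Q * (2 * T).+1)%N.
Proof.
rewrite /cost /round -map_comp -[in RHS](size_iota 0 Q).
by elim: (iota 0 Q) => //= t ts ->; rewrite mulSn.
Qed.

Lemma missed_sub f (A : {set 'I_k}) (blk : 'I_d -> {set X}) : missed y f A blk \subset A.
Proof. by apply/subsetP => i; rewrite inE => /andP[]. Qed.

Definition sampled : pred X := fun a => (rank_block l a < Q * d)%N.

Definition survivors f (A : {set 'I_k}) (s : Om) : {set 'I_k} :=
  [set i in A | [forall x in fiber f i,
     ~~ lonely sampled (rank_block l) (wset f A) s x]].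

(** The unfound set only shrinks during a round, so a preimage that is lonely for [A] is still alone
    when its block is searched. *)
Lemma left_after_survivors f A s :
  left_after y f s A round \subset survivors f A s.
Proof.
have sub ts (B : {set 'I_k}) : left_after y f s B [seq (T, fun (s : Om) (b : 'I_d) =>
     [set x | rank_block l (s x) == (t * d + b)%N]) | t <- ts] \subset B.
  elim: ts B => //= t ts IH B; apply: subset_trans (IH _) _; exact: missed_sub.
apply/subsetP => i; rewrite inE => iL.
have iA : i \in A by apply: subsetP iL; exact: sub.
rewrite iA; apply/forall_inP => x; rewrite inE => /eqP fx.
apply/negP => /andP[]; rewrite /sampled => inD /forall_inP uq.
set c := rank_block l (s x) in inD uq.
(* Block [c] is searched in batch [c %/ d] by processor [c %% d]. *)
have tQ : (c %/ d)%N \in iota 0 Q by rewrite mem_iota /= ltn_divLR.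
have bd : (c %% d < d)%N by rewrite ltn_pmod.
have key ts (B : {set 'I_k}) : B \subset A -> (c %/ d)%N \in ts ->
   i \notin left_after y f s B [seq (T, fun (s : Om) (b : 'I_d) =>
     [set x | rank_block l (s x) == (t * d + b)%N]) | t <- ts].
  elim: ts B => //= t ts IH B BA; rewrite inE => /orP[/eqP tE|]; last first.
    by apply: IH; apply: subset_trans BA; exact: missed_sub.
  apply: contraTN isT => /(subsetP (sub _ _)); rewrite inE => /andP[iB].
  move/negP; case; apply/existsP; exists (Ordinal bd); apply/existsP; exists x.
  rewrite fx eqxx andbT; apply/and3P; split.
  - by rewrite inE -tE /= -divn_eq.
  - by apply/exists_inP; exists i; rewrite // fx.
  apply/forall_inP => z; rewrite inE -tE /= -divn_eq => zc.
  apply/implyP => /(wantedS BA) zA.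
  by have := uq z; rewrite inE zA zc => /(_ isT).
by have /negP[] := key _ _ (subxx A) tQ.
Qed.

Notation M := (minn #|X| (Q * d * l)).

Lemma card_sampled : #|sampled| = M.
Proof.
rewrite -card_rank_lt; apply: eq_card => x.
by rewrite !inE /sampled /rank_block unfold_in ltn_divLR // muln_gt0 T0.
Qed.

Lemma card_Bits_gt1 : (1 < #|X|)%N.
Proof. by rewrite card_Bits -{1}(expn0 2) ltn_exp2l. Qed.

(** [survive] is summed over the items: its first term occurs at most [k] times, and the fiber sizes
    in its second term add up to [#|wset f A|]. *)
Lemma sum_survivors f A : promised y f ->
  \sum_s (#|wset f (survivors f A s)|%:R : R)
  <= #|Om|%:R * (4 * k%:R * ((M < #|X|)%:R * (#|X|%:R / M%:R))
       + 2 * #|wset f A|%:R ^+ 2 * (l.-1%:R / #|X|.-1%:R)).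
Proof.
move=> pf.
have M0 : (0 < M)%N.
  by rewrite leq_min (ltn_trans _ card_Bits_gt1) // !muln_gt0 Q0 d0 T0.
under eq_bigr do rewrite card_wset.
under eq_bigr do rewrite natr_sum big_mkcond /=.
rewrite exchange_big /=.
set a := (M < _)%:R * _; set c := (_ / #|X|.-1%:R).
apply: (@le_trans _ _ (\sum_(i in A)
   #|Om|%:R * (4 * a + 2 * #|fiber f i|%:R * #|wset f A|%:R * c))).
  rewrite [leRHS]big_mkcond; apply: ler_sum => i _.
  case: ifPn => [iA|niA]; last first.
    by rewrite big1 // => s _; rewrite inE (negPf niA).
  have S0 : (0 < #|fiber f i|)%N.
    by have [x fx] := pf i; apply/card_gt0P; exists x; rewrite inE fx.
  have M0' : (0 < #|sampled|)%N by rewrite card_sampled.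
  have bs x : sampled x ->
      (#|[pred b : X | rank_block l b == rank_block l x]| <= l)%N.
    by move=> _; apply: card_rank_block; rewrite muln_gt0 T0.
  have := survive R bs card_Bits_gt1 M0' (wset f A) S0.
  rewrite card_sampled -/c -(mulrA 4) -/a; apply: le_trans.
  set G := [set s | _]; rewrite -[#|G|]sum1_card natr_sum mulr_sumr.
  rewrite [leRHS]big_mkcond; apply: ler_sum => s _.
  by rewrite !inE iA mulr1.
rewrite -mulr_sumr ler_wpM2l ?ler0n // big_split /= sumr_const.
rewrite -mulr_suml -mulr_suml -mulr_sumr -natr_sum -card_wset lerD //; last first.
  by rewrite expr2 !mulrA.
rewrite -[leLHS]mulr_natl mulrCA mulrA ler_wpM2r //.
  by rewrite mulr_ge0 ?divr_ge0 ?ler0n.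
rewrite ler_wpM2l // ler_nat -[leqRHS]card_ord; exact: max_card.
Qed.

End Round.

(** * Reductions of the number of wanted addresses, and their composition *)

Section Reduce.
Variables (n m d k : nat) (y : {ffun 'I_k -> Bits m}).
Hypotheses (n0 : (0 < n)%N) (d0 : (0 < d)%N) (yI : injective y).
Notation F := (database n m).
Notation X := (Bits n).
Notation N := (expn 2 n).

(* [nu], [nu']: number of wanted addresses before and after; [e]: failure
   probability; [c]: number of parallel queries. *)
Definition reduces (nu nu' e c : R) := 0 <= e /\
  exists (Om : finType) (sc : schedule n d Om),
  [/\ (0 < #|Om|)%N, valid sc, (cost sc)%:R <= c &
   forall f, promised y f -> forall A, #|wset y f A|%:R <= nu ->
     #|[set w | nu' < #|wset y f (left_after y f w A sc)|%:R]|%:R <= e * #|Om|%:R].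

Lemma reduces_weaken nu nu1 nu' nu1' e e1 c c1 : nu1 <= nu -> nu' <= nu1' ->
  e <= e1 -> c <= c1 -> reduces nu nu' e c -> reduces nu1 nu1' e1 c1.
Proof.
move=> lnu lnu' le lc [e0 [Om [sc [Om0 vsc csc h]]]].
split; first exact: le_trans le.
exists Om, sc; split=> // [|f pf A hA]; first exact: le_trans lc.
apply: (@le_trans _ _ (e * #|Om|%:R)); last by rewrite ler_wpM2r ?ler0n.
apply: le_trans (h f pf A (le_trans hA lnu)).
rewrite ler_nat; apply/subset_leq_card/subsetP => w; rewrite !inE.
exact: le_lt_trans.
Qed.

Lemma reduces_refl nu : reduces nu nu 0 0.
Proof.
split=> //; exists unit, [::]; split=> //; first by rewrite card_unit.
move=> f _ A hA; rewrite mul0r (_ : [set _ | _] = set0) ?cards0 //.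
by apply/setP => w; rewrite !inE ltNge hA.
Qed.

Definition relabel (Om Om' : finType) (g : Om' -> Om) (sc : schedule n d Om) :
    schedule n d Om' := [seq (e.1, fun w => e.2 (g w)) | e <- sc].

Lemma valid_relabel (Om Om' : finType) (g : Om' -> Om) sc :
  valid sc -> valid (relabel g sc).
Proof. by elim: sc => //= e sc IH [T0 blkT /IH]. Qed.

Lemma valid_cat (Om : finType) (sc sc' : schedule n d Om) :
  valid sc -> valid sc' -> valid (sc ++ sc').
Proof. by elim: sc => //= e sc IH [T0 blkT /IH h] /h. Qed.

Lemma left_after_relabel (Om Om' : finType) (g : Om' -> Om) sc f A w :
  left_after y f w A (relabel g sc) = left_after y f (g w) A sc.
Proof. by rewrite /left_after; elim: sc A => //= e sc IH A; rewrite IH. Qed.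

Lemma cost_relabel (Om Om' : finType) (g : Om' -> Om) sc :
  cost (relabel g sc) = cost sc.
Proof. by rewrite /cost -map_comp. Qed.

Lemma cost_cat (Om : finType) (sc sc' : schedule n d Om) :
  cost (sc ++ sc') = (cost sc + cost sc')%N.
Proof. by rewrite /cost map_cat sumn_cat. Qed.

(** The schedules use independent random choices, on a product type. The second guarantee holds for
    every starting set, hence after every success of the first; a union bound adds the failures. *)
Lemma reduces_trans nu1 nu2 nu3 e1 e2 c1 c2 :
  reduces nu1 nu2 e1 c1 -> reduces nu2 nu3 e2 c2 ->
  reduces nu1 nu3 (e1 + e2) (c1 + c2).
Proof.
move=> [e10 [Om1 [sc1 [O1 v1 cs1 h1]]]] [e20 [Om2 [sc2 [O2 v2 cs2 h2]]]].
split; first exact: addr_ge0.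
exists (Om1 * Om2)%type.
exists (relabel (@fst _ _) sc1 ++ relabel (@snd _ _) sc2); split.
- by rewrite card_prod muln_gt0 O1.
- by apply: valid_cat; exact: valid_relabel.
- by rewrite cost_cat !cost_relabel natrD lerD.
move=> f pf A hA; rewrite -sum1_card natr_sum.
rewrite (eq_bigl (fun w => nu3 <
  #|wset y f (left_after y f w.2 (left_after y f w.1 A sc1) sc2)|%:R)); last first.
  by move=> w; rewrite inE /left_after foldl_cat -!/(left_after _ _ _ _ _) !left_after_relabel.
rewrite big_mkcond -(pair_bigA _ (fun w1 w2 => if nu3 <
  #|wset y f (left_after y f w2 (left_after y f w1 A sc1) sc2)|%:R then 1 else 0)) /=.
set bad1 := fun w1 => nu2 < #|wset y f (left_after y f w1 A sc1)|%:R.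
apply: (@le_trans _ _ (\sum_w1 (#|Om2|%:R * (bad1 w1)%:R + e2 * #|Om2|%:R))).
  apply: ler_sum => w1 _; rewrite -big_mkcond /= /bad1.
  case: ltP => [_|ok].
    rewrite mulr1 ler_wpDr ?mulr_ge0 ?ler0n // sumr_const ler_nat; exact: max_card.
  rewrite mulr0 add0r; apply: le_trans (h2 f pf _ ok).
  by rewrite sumr_const ler_nat; apply/subset_leq_card/subsetP => w; rewrite inE.
rewrite big_split /= -mulr_sumr sumr_const card_prod natrM.
have -> : \sum_w1 (bad1 w1)%:R = #|[set w | bad1 w]|%:R :> R.
  rewrite -sum1_card natr_sum [RHS]big_mkcond; apply: eq_bigr => w _.
  by rewrite inE; case: (bad1 w).
have := h1 f pf A hA; rewrite -/bad1 => h.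
rewrite mulrDl lerD //.
  by rewrite [leRHS]mulrA [leRHS]mulrC ler_wpM2l.
by rewrite -[_ *+ _]mulr_natl mulrCA.
Qed.

(** Fewer than one wanted address means none, and by the promise an unfound item would have a wanted
    preimage. *)
Lemma reduces_solves nu' e c : nu' < 1 -> e <= 1 / 4 ->
  reduces N%:R nu' e c ->
  exists T, T%:R <= c /\ solves_with_queries n m d k y T.
Proof.
move=> nu1 e4 [e0 [Om [sc [Om0 vsc csc h]]]].
exists (cost sc); split=> //; apply: schedule_solves => // f pf.
have hT : #|wset y f setT|%:R <= N%:R :> R.
  by rewrite ler_nat -card_Bits max_card.
have := h f pf setT hT; set B := [set w | _] => hB.
apply: (@le_trans _ _ #|~: B|%:R); last first.
  rewrite ler_nat; apply/subset_leq_card/subsetP => w; rewrite !inE -leNgt => le.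
  have : (#|wset y f (left_after y f w [set: 'I_k] sc)| < 1)%N.
    by rewrite -(ltr_nat R); exact: le_lt_trans nu1.
  rewrite ltnS leqn0 cards_eq0 => /eqP w0.
  apply/eqP/setP => i; rewrite inE; apply/negbTE/negP => iL.
  have [x fx] := pf i; have : x \in set0.
    by rewrite -w0 inE; apply/exists_inP; exists i; rewrite ?fx.
  by rewrite inE.
have := cardsC B; move/(congr1 (fun a => a%:R : R)); rewrite natrD /=.
have : e * #|Om|%:R <= 1 / 4 * #|Om|%:R by rewrite ler_wpM2r ?ler0n.
by move: hB; set a := #|B|%:R; set b := #|~: B|%:R; set o := #|_|%:R => *; lra.
Qed.

(** Markov's inequality applied to [sum_survivors], with the real parameters [w] and [P] rounded to
    integers. *)
Lemma reduces_round (nu nu' w P e c : R) :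
  0 <= nu -> 0 < nu' -> 0 < w -> 0 < P -> P <= 1 ->
  (4 * k%:R * ((P != 1)%:R / P) + 4 * nu ^+ 2 * w ^+ 2 / N%:R) / nu' <= e ->
  3 * (1 + w) + 6 * (P * N%:R) / (d%:R * w) <= c ->
  reduces nu nu' e c.
Proof.
move=> nu0 nu'0 w0 P0 P1 he hc.
have N2 : 2 <= N%:R :> R by rewrite ler_nat -{1}(expn1 2) leq_exp2l.
have dR : 0 < d%:R :> R by rewrite ltr0n.
(* Rounding [max 1 w] down to [T] gives [T >= 1], [w <= 2 T] and [T ^ 2 - 1 <= w ^ 2]. The last
   suffices because only [l.-1] enters the clash bound. *)
pose mw := Num.max 1 w.
have [mw1 mww] : 1 <= mw /\ w <= mw by rewrite !le_max !lexx orbT.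
have mwle : mw <= 1 + w by rewrite ge_max; apply/andP; split; lra.
have /andP[Tle Tgt] := truncn_itv (le_trans ler01 mw1).
set T := Num.truncn mw in Tle Tgt.
have T0 : (0 < T)%N.
  by rewrite lt0n; apply: contraTneq Tgt => ->; rewrite -leNgt.
have TR : 1 <= T%:R :> R by rewrite ler1n.
have pos : 0 <= P * N%:R / (d%:R * (T * T)%:R).
  by rewrite divr_ge0 ?mulr_ge0 ?ler0n // ltW.
have /andP[Qle Qgt] := truncn_itv pos.
set Q0 := Num.truncn _ in Qle Qgt.
have Td : 0 < d%:R * (T * T)%:R :> R by rewrite mulr_gt0 // natrM mulr_gt0 //; lra.
have PM : P * N%:R <= (minn #|X| (Q0.+1 * d * (T * T)))%:R.
  rewrite natr_min le_min card_Bits; apply/andP; split.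
    by rewrite ler_piMl ?ler0n.
  move: Qgt; rewrite ltr_pdivrMr // => /ltW.
  by rewrite (natrM _ (Q0.+1 * d)) (natrM _ Q0.+1) -mulrA.
split.
  apply: le_trans he; apply: divr_ge0; last exact: ltW.
  by rewrite addr_ge0 // ?divr_ge0 ?mulr_ge0 ?ler0n ?sqr_ge0 ?invr_ge0 // ltW.
exists {perm X}, (round n d Q0.+1 T); split.
- by apply/card_gt0P; exists 1%g; rewrite inE.
- exact: round_valid.
- rewrite round_cost; apply: le_trans hc.
  rewrite natrM -!natr1 natrM.
  move: Qle; rewrite ler_pdivlMr // natrM.
  set t := T%:R in Tgt Tle TR *; set q := Q0%:R => Qle.
  have q0 : 0 <= q by rewrite ler0n.
  have w2t : w <= 2 * t by move: Tgt; rewrite -natr1 -/t; lra.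
  have : 3 * t * q <= 6 * (P * N%:R) / (d%:R * w).
    rewrite ler_pdivlMr ?mulr_gt0 //.
    apply: (@le_trans _ _ (6 * (q * (d%:R * (t * t))))); last by lra.
    have -> : 6 * (q * (d%:R * (t * t))) = 3 * t * q * (d%:R * (2 * t)) by ring.
    by rewrite ler_wpM2l ?mulr_ge0 ?ler_pM2l //; lra.
  by nra.
move=> f pf A hA.
have := sum_survivors n0 d0 yI (ltn0Sn Q0) T0 A pf.
set M := minn _ _ in PM *; set g := #|wset y f A|%:R in hA *.
set a := (M < _)%:R * _; set c' := (_ / #|X|.-1%:R) => hs.
have ha : a <= (P != 1)%:R / P.
  rewrite /a; case: ltnP => [lt|_]; last by rewrite mul0r divr_ge0 ?ler0n // ltW.
  have M0 : 0 < M%:R :> R by apply: lt_le_trans PM; rewrite mulr_gt0 //; lra.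
  (* The sample has at least [P N] addresses, so it can only be proper if [P] differs from 1. *)
  have -> : P != 1.
    apply: contraTneq lt => P1'; rewrite -leqNgt -(ler_nat R).
    by move: PM; rewrite P1' mul1r card_Bits.
  rewrite !mul1r ler_pdivrMr // mulrC ler_pdivlMr // mulrC card_Bits.
  exact: PM.
have hc' : c' <= 2 * w ^+ 2 / N%:R.
  have eN : N%:R = N.-1%:R + 1 :> R by rewrite natr1 prednK // expn_gt0.
  have N1 : 0 < N.-1%:R :> R by move: N2; rewrite eN; lra.
  have eT : (T * T)%:R = (T * T).-1%:R + 1 :> R.
    by rewrite natr1 prednK // muln_gt0 T0.
  have T2 : (T * T).-1%:R <= w ^+ 2.
    suff : (T * T)%:R <= w ^+ 2 + 1 by rewrite eT; lra.
    rewrite natrM; move: Tle mw1; rewrite /mw maxEle; case: ifP => _; nra.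
  rewrite /c' card_Bits ler_pdivrMr // mulrAC ler_pdivlMr; last by lra.
  apply: (@le_trans _ _ (w ^+ 2 * N%:R)).
    by rewrite ler_wpM2r ?ler0n.
  rewrite (_ : 2 * _ * _ = w ^+ 2 * (2 * N.-1%:R)); last by ring.
  rewrite ler_wpM2l ?sqr_ge0 //.
  by move: N2; rewrite eN; lra.
have g0 : 0 <= g by rewrite ler0n.
set B := [set w | _].
have hB : nu' * #|B|%:R <= \sum_s (#|wset y f (survivors d y Q0.+1 T f A s)|%:R : R).
  rewrite -sum1_card natr_sum mulr_sumr [leLHS]big_mkcond; apply: ler_sum => s _.
  rewrite inE; case: ifP => [/ltW h|_]; last by rewrite ler0n.
  rewrite mulr1; apply: le_trans h _; rewrite ler_nat; apply/subset_leq_card.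
  apply/subsetP => x; rewrite !inE; apply: wantedS.
  exact: left_after_survivors.
have hO : 0 <= #|{perm X}|%:R :> R by rewrite ler0n.
have k0 : 0 <= k%:R :> R by rewrite ler0n.
have hg : g ^+ 2 * c' <= nu ^+ 2 * (2 * w ^+ 2 / N%:R).
  have c0 : 0 <= c' by rewrite divr_ge0 ?ler0n.
  by apply: ler_pM; rewrite ?sqr_ge0 // ler_pXn2r ?nnegrE.
rewrite -(ler_pM2l nu'0); apply: le_trans hB _; apply: le_trans hs _.
have he' : 4 * k%:R * ((P != 1)%:R / P) + 4 * nu ^+ 2 * w ^+ 2 / N%:R <= nu' * e.
  by move: he; rewrite ler_pdivrMr // => h; rewrite (mulrC nu').
rewrite (_ : nu' * (e * _) = #|{perm X}|%:R * (nu' * e)); last by ring.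
rewrite ler_wpM2l //; apply: le_trans he'; apply: lerD.
  by rewrite ler_wpM2l // mulr_ge0.
rewrite -mulrA.
have -> : 4 * nu ^+ 2 * w ^+ 2 / N%:R = 2 * (nu ^+ 2 * (2 * w ^+ 2 / N%:R)) by ring.
by rewrite ler_wpM2l.
Qed.

End Reduce.

(** * Choice of the parameters *)

Local Open Scope R_scope.

Lemma pow_above (b x : R) : 1 < b -> 1 <= x -> exists J : nat, x <= b ^ J <= b * x.
Proof.
move=> b1 x1; have [J0 h0] : exists J : nat, x <= b ^ J.
  have [J h] := Pow_x_infinity b (eq_ind_r (fun z => z > 1) b1 (Rabs_pos_eq b ltac:(stdlra))) x.
  exists J; have := h J (Nat.le_refl J).
  by rewrite Rabs_pos_eq; [stdlra | apply: pow_le; stdlra].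
elim: J0 h0 => [|J IH] h.
  by exists 0%N; split=> //; rewrite /= in h *; stdnra.
have [lt|ge] := Rlt_le_dec (b ^ J) x; last exact: IH.
by exists J.+1; split=> //=; apply: Rmult_le_compat_l; stdlra.
Qed.

Lemma INR_le_pow (b : R) (J : nat) : 2 <= b -> INR J <= b ^ J.
Proof.
move=> b2; elim: J => [|J IH]; first by rewrite /=; stdlra.
have p1 : 1 <= b ^ J by apply: pow_R1_Rle; stdlra.
by rewrite S_INR /=; stdnra.
Qed.

Section Numerics.
Variables (n m d k : nat) (y : {ffun 'I_k -> Bits m}).
Hypotheses (n0 : (0 < n)%N) (d0 : (0 < d)%N) (yI : injective y).
Notation N := (INR (expn 2 n)).
Notation D := (INR d).
Notation K := (INR k).
Notation red := (reduces n d y).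

Lemma sparse_round (nu nu' w P e c : R) :
  0 <= nu -> 0 < nu' -> 0 < w -> 0 < P -> P <= 1 ->
  4 * K / P / nu' + 4 * (nu * nu) * (w * w) / N / nu' <= e ->
  3 * (1 + w) + 6 * (P * N) / (D * w) <= c ->
  red nu nu' e c.
Proof.
move=> /RleP a1 /RltP a2 /RltP a3 /RltP a4 /RleP a5 /RleP he /RleP hc.
apply: (reduces_round n0 d0 yI a1 a2 a3 a4 a5); last first.
  by move: hc; rewrite !RealsE.
apply: le_trans he; rewrite !RealsE mulrDl; apply: lerD; last by rewrite !expr2.
rewrite ler_wpM2r ?invr_ge0 ?(ltW a2) //.
rewrite ler_wpM2l ?mulr_ge0 ?ler0n //.
by case: (_ != _); rewrite ?mul1r ?mul0r ?invr_ge0 ?(ltW a4).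
Qed.

Lemma full_round (nu nu' w e c : R) :
  0 <= nu -> 0 < nu' -> 0 < w ->
  4 * (nu * nu) * (w * w) / N / nu' <= e ->
  3 * (1 + w) + 6 * N / (D * w) <= c ->
  red nu nu' e c.
Proof.
move=> /RleP a1 /RltP a2 /RltP a3 /RleP he /RleP hc.
apply: (reduces_round n0 d0 yI a1 a2 a3 ltr01 (lexx 1%R)); last first.
  by move: hc; rewrite !RealsE mul1r.
by rewrite eqxx mul0r mulr0 add0r; apply: le_trans he; rewrite !RealsE !expr2.
Qed.

Lemma red_weaken nu nu1 nu' nu1' e e1 c c1 : nu1 <= nu -> nu' <= nu1' ->
  e <= e1 -> c <= c1 -> red nu nu' e c -> red nu1 nu1' e1 c1.
Proof. by move=> /RleP a1 /RleP a2 /RleP a3 /RleP a4; exact: reduces_weaken. Qed.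

Lemma red_trans nu1 nu2 nu3 e1 e2 c1 c2 :
  red nu1 nu2 e1 c1 -> red nu2 nu3 e2 c2 -> red nu1 nu3 (e1 + e2) (c1 + c2).
Proof. exact: reduces_trans. Qed.

(* To be used with [L = sqrt (N / D)] and [kappa = max (K, D)]. *)
Variables L q : R.
Hypotheses (L1 : 1 <= L) (q1 : 1 <= q) (qL : q <= L) (NE : N = L * L * D).
Notation kappa := (q * q * D).

Let D0 : 0 < D. Proof. by apply: lt_0_INR; apply/ssrnat.ltP. Qed.
Let K0 : 0 <= K. Proof. exact: pos_INR. Qed.

(* With [z = 2 ^ j]: sample density [min (1, 256 / z ^ 5)], blocks of about
   [(L / q / 1024 / z ^ 4) ^ 2] addresses. *)
Lemma coarse_step z : K <= kappa -> 1 <= z ->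
  red (64 * (kappa * z ^ 6)) (kappa * z ^ 6) (1 / 32 / z)
      (3 + 1572865 * (L * q) / z).
Proof.
move=> Kk z1.
have z6 : 0 < z ^ 6 by apply: pow_lt; stdlra.
have z5 : 0 < z ^ 5 by apply: pow_lt; stdlra.
have z4 : 0 < z ^ 4 by apply: pow_lt; stdlra.
have kap0 : 0 < kappa by apply: Rmult_lt_0_compat => //; stdnra.
have nu0 : 0 < kappa * z ^ 6 by apply: Rmult_lt_0_compat.
pose w := L / q / 1024 / z ^ 4.
have w0 : 0 < w by do 3 (apply: Rdiv_lt_0_compat => //; try stdlra).
(* Collisions and insufficient sampling each receive half of the failure probability
   [1 / (32 z)]. *)
have err : 4 * ((64 * (kappa * z ^ 6)) * (64 * (kappa * z ^ 6))) * (w * w) / N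
    / (kappa * z ^ 6) = 1 / 64 / z * / z.
  by rewrite NE /w; stdfield; repeat split; stdlra.
have iz : 0 < / z by apply: Rinv_0_lt_compat; stdlra.
have iz1 : / z <= 1 by rewrite -Rinv_1; apply: Rinv_le_contravar; stdlra.
have iz4 : / z ^ 4 <= / z.
  apply: Rinv_le_contravar; first by stdlra.
  by rewrite -[X in X <= _](pow_1 z); apply: Rle_pow => //; lia.
have wle : 3 * w <= L * q / z.
  have -> : 3 * w = 3 / 1024 * (L / q) * / z ^ 4 by rewrite /w; stdfield; stdlra.
  have : L / q <= L * q.
    by rewrite /Rdiv; apply: Rmult_le_compat_l; [stdlra|];
       apply: Rle_trans q1; rewrite -Rinv_1; apply: Rinv_le_contravar; stdlra.
  have Lq0 : 0 < L / q by apply: Rdiv_lt_0_compat; stdlra.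
  move=> Lq; apply: Rmult_le_compat => //; try stdlra.
  by apply: Rlt_le; apply: Rinv_0_lt_compat.
have cst : 6 * (256 / z ^ 5 * N) / (D * w) = 1572864 * (L * q) / z.
  by rewrite NE /w; stdfield; repeat split; stdlra.
have err' : 1 / 64 / z * / z <= 1 / 64 / z.
  have : 0 < 1 / 64 / z by rewrite /Rdiv; stdlra.
  by stdnra.
(* If the density would exceed 1, everything is searched with the same [w], at a smaller cost than
   the one computed. *)
have [P1|P1] := Rle_lt_dec (256 / z ^ 5) 1.
  apply: (@sparse_round _ _ w (256 / z ^ 5)) => //; try stdlra.
  - by apply: Rdiv_lt_0_compat => //; stdlra.
  - rewrite err.
    have -> : 4 * K / (256 / z ^ 5) / (kappa * z ^ 6) = 1 / 64 / z * (K / kappa).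
      by stdfield; repeat split; stdlra.
    have : K / kappa <= 1 by apply/(Rmult_le_reg_r kappa) => //;
      rewrite /Rdiv Rmult_assoc Rinv_l; stdlra.
    have : 0 < 1 / 64 / z by rewrite /Rdiv; stdlra.
    have -> : 1 / 32 / z = 1 / 64 / z + 1 / 64 / z by stdfield; stdlra.
    by stdnra.
apply: (@full_round _ _ w) => //; try stdlra.
have : 6 * N / (D * w) <= 6 * (256 / z ^ 5 * N) / (D * w).
  apply: Rmult_le_compat_r.
    by apply: Rlt_le; apply: Rinv_0_lt_compat; apply: Rmult_lt_0_compat.
  have N0 : 0 < N by rewrite NE; apply: Rmult_lt_0_compat => //; stdnra.
  by stdnra.
by stdlra.
Qed.


(** Each halving of [z] divides the bound by 64. Failures and main costs form geometric series,
    whose partial sums carry the factor [1 - / 2 ^ J]. *)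
Lemma coarse_phase (J : nat) : K <= kappa ->
  red (kappa * (2 ^ J) ^ 6) kappa (1 / 16 * (1 - / 2 ^ J))
      (3 * INR J + 3145730 * (L * q) * (1 - / 2 ^ J)).
Proof.
move=> Kk; elim: J => [|J IH].
  apply: red_weaken (reduces_refl n d y kappa) => /=; try stdlra.
set z := 2 ^ J in IH *.
have z1 : 1 <= z by apply: pow_R1_Rle; stdlra.
have zS : 2 ^ J.+1 = 2 * z by [].
have iz : / (2 * z) = / z / 2 by stdfield; stdlra.
have h := red_trans (coarse_step Kk z1) IH.
apply: red_weaken h; rewrite ?S_INR ?zS ?iz.
- by apply: Req_le; stdring.
- exact: Rle_refl.
- by apply: Req_le; stdfield; stdlra.
- by apply: Req_le; stdfield; stdlra.
Qed.

Lemma coarse_reduction : K <= kappa ->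
  red N kappa (1 / 16) (4000000 * (L * q)).
Proof.
move=> Kk.
have G1 : 1 <= L / q.
  by apply: (Rmult_le_reg_r q); rewrite /Rdiv ?Rmult_assoc ?Rinv_l; stdlra.
have GH : L / q <= L * q.
  apply: (Rmult_le_reg_r q); first by stdlra.
  rewrite /Rdiv Rmult_assoc Rinv_l; last by stdlra.
  have qq : 1 <= q * q by stdnra.
  by stdnra.
(* [8 ^ J >= L / q] gives [kappa * 64 ^ J >= N], and [J <= 8 ^ J <= 8 L / q] keeps the additive cost
   [3 J] of order [L q]. *)
have [J [J1 J2]] := @pow_above 8 (L / q) ltac:(stdlra) G1.
have J3 := INR_le_pow J (b := 8) ltac:(stdlra).
have i0 : 0 < / 2 ^ J by apply: Rinv_0_lt_compat; apply: pow_lt; stdlra.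
apply: red_weaken (coarse_phase J Kk); try stdlra.
  have -> : (2 ^ J) ^ 6 = 8 ^ J * 8 ^ J.
    have -> : 8 = 2 ^ 3 by rewrite /=; stdring.
    by rewrite -!pow_mult -pow_add; congr (2 ^ _); lia.
  have hL : L <= 8 ^ J * q.
    have -> : L = L / q * q by stdfield; stdlra.
    by apply: Rmult_le_compat_r; stdlra.
  have hLL : L * L <= (8 ^ J * q) * (8 ^ J * q) by apply: Rmult_le_compat; stdlra.
  have := Rmult_le_compat_r D _ _ (Rlt_le _ _ D0) hLL.
  by rewrite NE; stdlra.
have e5 : 0 < L * q * / 2 ^ J by apply: Rmult_lt_0_compat => //; stdnra.
by stdlra.
Qed.

(** Here [z] grows. As the bound falls like [1 / z ^ 3], blocks of about [(L z / (64 q)) ^ 2]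
    addresses still keep the collision term at [1 / (128 z)]. *)
Lemma fine_step z : 1 <= z ->
  red (kappa / z ^ 3) (kappa / (2 * z) ^ 3) (1 / 128 / z)
      (3 + 3 / 64 * (L / q) * z + 384 * (L * q) / z).
Proof.
move=> z1.
have z3 : 0 < z ^ 3 by apply: pow_lt; stdlra.
have z3' : 0 < (2 * z) ^ 3 by apply: pow_lt; stdlra.
have kap0 : 0 < kappa by apply: Rmult_lt_0_compat => //; stdnra.
have Lq0 : 0 < L / q by apply: Rdiv_lt_0_compat; stdlra.
pose w := L / q * z / 64.
apply: (@full_round _ _ w).
- by apply: Rlt_le; apply: Rdiv_lt_0_compat.
- by apply: Rdiv_lt_0_compat.
- by apply: Rdiv_lt_0_compat; [apply: Rmult_lt_0_compat; stdlra | stdlra].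
- by apply: Req_le; rewrite NE /w; stdfield; repeat split; stdlra.
- by apply: Req_le; rewrite NE /w; stdfield; repeat split; stdlra.
Qed.

Lemma fine_phase (J : nat) :
  red kappa (kappa / (2 ^ J) ^ 3) (1 / 64 * (1 - / 2 ^ J))
      (3 * INR J + 3 / 64 * (L / q) * (2 ^ J - 1) + 768 * (L * q) * (1 - / 2 ^ J)).
Proof.
elim: J => [|J IH].
  apply: red_weaken (reduces_refl n d y kappa);
    rewrite /= ?Rmult_1_r ?Rdiv_1_r ?Rinv_1; stdlra.
set z := 2 ^ J in IH *.
have z1 : 1 <= z by apply: pow_R1_Rle; stdlra.
have zS : 2 ^ J.+1 = 2 * z by [].
have iz : / (2 * z) = / z / 2 by stdfield; stdlra.
have h := red_trans IH (fine_step z1).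
apply: red_weaken h; rewrite ?S_INR ?zS ?iz.
- exact: Rle_refl.
- exact: Rle_refl.
- by apply: Req_le; stdfield; stdlra.
- by apply: Req_le; stdfield; stdlra.
Qed.

Lemma fine_reduction : red kappa (D / 2 ^ 16) (1 / 64) (2000 * (L * q)).
Proof.
have q64 : 1 <= 64 * q by stdlra.
(* Stopping with [2 ^ J] between [64 q] and [128 q] brings the bound below [D / 2 ^ 16], while the
   growing cost [(L / q) * 2 ^ J] stays of order [L]. *)
have [J [J1 J2]] := @pow_above 2 (64 * q) ltac:(stdlra) q64.
have J3 := INR_le_pow J (b := 2) ltac:(stdlra).
have i0 : 0 < / 2 ^ J by apply: Rinv_0_lt_compat; apply: pow_lt; stdlra.
set z := 2 ^ J in J1 J2 J3 i0.
have Lq0 : 0 < L / q by apply: Rdiv_lt_0_compat; stdlra.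
have z3 : 0 < z ^ 3 by apply: pow_lt; stdlra.
apply: red_weaken (fine_phase J); rewrite -/z; try stdlra.
  have h : (64 * q) ^ 3 <= z ^ 3 by apply: pow_incr; stdlra.
  apply: (Rmult_le_reg_r (z ^ 3)) => //.
  rewrite /Rdiv Rmult_assoc Rinv_l; last by stdlra.
  have : q * q * 2 ^ 16 <= z ^ 3.
    apply: Rle_trans h; rewrite /=; stdnra.
  rewrite /=; stdnra.
have e1 : 3 / 64 * (L / q) * (z - 1) <= 3 / 64 * (L / q) * (128 * q).
  by apply: Rmult_le_compat_l; stdlra.
have e2 : 3 / 64 * (L / q) * (128 * q) = 6 * L by stdfield; stdlra.
have e3 : q <= L * q by stdnra.
have e4 : L <= L * q by stdnra.
have e5 : 0 < L * q * / z by apply: Rmult_lt_0_compat => //; stdnra.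
by stdlra.
Qed.

(** With [w = L] the collision term is 2 to the power [2 + (s + 1) ^ 2 - 2 s ^ 2], which is at most
    [- (s + 1)] from [s = 4] on. Hence the starting point [D / 2 ^ 16]. *)
Lemma tail_step (s : nat) : (4 <= s)%N ->
  red (D / 2 ^ (s * s)) (D / 2 ^ (s.+1 * s.+1)) (/ 2 ^ s.+1) (12 * L).
Proof.
move=> s4.
have p1 : 0 < 2 ^ (s * s) by apply: pow_lt; stdlra.
have p2 : 0 < 2 ^ (s.+1 * s.+1) by apply: pow_lt; stdlra.
have p3 : 0 < 2 ^ s.+1 by apply: pow_lt; stdlra.
apply: (@full_round _ _ L); try stdlra.
- by apply: Rlt_le; apply: Rdiv_lt_0_compat.
- by apply: Rdiv_lt_0_compat.
- have -> : 4 * (D / 2 ^ (s * s) * (D / 2 ^ (s * s))) * (L * L) / N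
      / (D / 2 ^ (s.+1 * s.+1))
    = (4 * 2 ^ (s.+1 * s.+1)) / (2 ^ (s * s) * 2 ^ (s * s)).
    by rewrite NE; stdfield; repeat split; stdlra.
  apply: (Rmult_le_reg_r (2 ^ (s * s) * 2 ^ (s * s) * 2 ^ s.+1)).
    by do 2 apply: Rmult_lt_0_compat => //.
  have -> : 4 * 2 ^ (s.+1 * s.+1) / (2 ^ (s * s) * 2 ^ (s * s)) *
     (2 ^ (s * s) * 2 ^ (s * s) * 2 ^ s.+1) = 2 ^ 2 * 2 ^ (s.+1 * s.+1) * 2 ^ s.+1.
    by rewrite /=; stdfield; stdlra.
  have -> : / 2 ^ s.+1 * (2 ^ (s * s) * 2 ^ (s * s) * 2 ^ s.+1)
    = 2 ^ (s * s) * 2 ^ (s * s) by stdfield; stdlra.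
  rewrite -!pow_add; apply: Rle_pow; first by stdlra.
  by move/ssrnat.leP: s4; rewrite -!multE; nia.
- have -> : 6 * N / (D * L) = 6 * L by rewrite NE; stdfield; split; stdlra.
  by stdlra.
Qed.

Lemma tail_phase (u : nat) :
  red (D / 2 ^ 16) (D / 2 ^ ((4 + u) * (4 + u))) (1 / 16 - / 2 ^ (4 + u))
      (12 * L * INR u).
Proof.
elim: u => [|u IH].
  apply: red_weaken (reduces_refl n d y (D / 2 ^ 16)); rewrite /=; try stdlra.
have h := red_trans IH (@tail_step (4 + u) isT).
have p3 : 0 < 2 ^ (4 + u) by apply: pow_lt; stdlra.
rewrite addnS; apply: red_weaken h; rewrite ?S_INR.
- exact: Rle_refl.
- exact: Rle_refl.
- have -> : 2 ^ (4 + u).+1 = 2 * 2 ^ (4 + u) by [].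
  by apply: Req_le; stdfield; stdlra.
- by apply: Req_le; stdring.
Qed.

End Numerics.

(** * Assembly of the phases for few and for many items *)

Section Assembly.
Variables (n m d k : nat) (y : {ffun 'I_k -> Bits m}).
Hypotheses (n0 : (0 < n)%N) (d0 : (0 < d)%N) (yI : injective y).
Notation N := (INR (expn 2 n)).
Notation D := (INR d).
Notation K := (INR k).
Notation red := (reduces n d y).
Variable L : R.
Hypotheses (L1 : 1 <= L) (NE : N = L * L * D).

Lemma red_solves nu' e c : nu' < 1 -> e <= 1 / 4 -> red N nu' e c ->
  exists T, INR T <= c /\ solves_with_queries n m d k y T.
Proof.
move=> /RltP nu1 /RleP e4; rewrite INRE => h.
have [||T [Tc sT]] := reduces_solves _ _ h => //.
  by move: e4; rewrite !RealsE.
by exists T; split=> //; apply/RleP; rewrite INRE.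
Qed.

Lemma few_items_reduction t : 1 <= t -> D = t ^ 4 -> K <= t * t ->
  red D (1 / 2) (1 / 64 + 1 / 64 + 1 / 128) (60000 * L).
Proof.
move=> t1 Dt Kt.
have K0 : 0 <= K := pos_INR k.
have t2 : 0 < t ^ 2 by apply: pow_lt; stdlra.
have t3 : 0 < t ^ 3 by apply: pow_lt; stdlra.
have t4 : 0 < t ^ 4 by apply: pow_lt; stdlra.
have it : / t <= 1 by rewrite -Rinv_1; apply: Rinv_le_contravar; stdlra.
have it0 : 0 < / t by apply: Rinv_0_lt_compat; stdlra.
have Lt : L / t <= L by rewrite /Rdiv; stdnra.
(* Density [1 / t] permits the smaller width [L / t] at cost of order [L]; the loss from sampling is
   controlled by [K <= t ^ 2]. *)
have r1 : red D (512 * t ^ 3) (1 / 64) (12 * L).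
  rewrite Dt; apply: (@sparse_round _ _ _ _ _ n0 d0 yI _ _ (L / t) (/ t));
    try stdlra.
  - by apply: Rdiv_lt_0_compat; stdlra.
  - have -> : 4 * (t ^ 4 * t ^ 4) * (L / t * (L / t)) / N / (512 * t ^ 3)
        = 1 / 128 * / t by rewrite NE Dt; stdfield; split; stdlra.
    have -> : 4 * K / / t / (512 * t ^ 3) = 1 / 128 * (K / (t * t)).
      by stdfield; stdlra.
    have : K / (t * t) <= 1.
      apply: (Rmult_le_reg_r (t * t)); first by stdnra.
      by rewrite /Rdiv Rmult_assoc Rinv_l; stdnra.
    by stdlra.
  have -> : 6 * (/ t * N) / (D * (L / t)) = 6 * L.
    by rewrite NE Dt; stdfield; split; stdlra.
  by stdlra.
have r2 : red (512 * t ^ 3) (t ^ 2) (1 / 64) (50000 * L).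
  apply: (@full_round _ _ _ _ _ n0 d0 yI _ _ (L / 8192)); try stdlra.
  - by apply: Req_le; rewrite NE Dt; stdfield; split; stdlra.
  have -> : 6 * N / (D * (L / 8192)) = 49152 * L.
    by rewrite NE Dt; stdfield; split; stdlra.
  by stdlra.
have r3 : red (t ^ 2) (1 / 2) (1 / 128) (200 * L).
  apply: (@full_round _ _ _ _ _ n0 d0 yI _ _ (L / 32)); try stdlra.
  - by apply: Req_le; rewrite NE Dt; stdfield; split; stdlra.
  have -> : 6 * N / (D * (L / 32)) = 192 * L.
    by rewrite NE Dt; stdfield; split; stdlra.
  by stdlra.
have h := red_trans (red_trans r1 r2) r3.
by apply: red_weaken h; stdlra.
Qed.

Lemma few_items : K * K <= D ->
  exists T, INR T <= 5000000 * L /\ solves_with_queries n m d k y T.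
Proof.
move=> KD.
have D1 : 1 <= D by rewrite -INR_1; apply: le_INR; apply/ssrnat.leP.
have K0 : 0 <= K := pos_INR k.
pose s := sqrt D; pose t := sqrt s.
have ss : s * s = D by apply: sqrt_sqrt; stdlra.
have s1 : 1 <= s by rewrite -sqrt_1; apply: sqrt_le_1; stdlra.
have tt : t * t = s by apply: sqrt_sqrt; stdlra.
have t1 : 1 <= t by rewrite -sqrt_1; apply: sqrt_le_1; stdlra.
have Dt : D = t ^ 4 by rewrite -ss -tt /=; stdring.
have Ks : K <= t * t by rewrite tt; stdnra.
have NE' : N = L * L * D by [].
(* Taking [q = 1] makes [kappa] equal to [D]. *)
have KD' : K <= 1 * 1 * D by stdnra.
have r1 := coarse_reduction n0 d0 yI L1 (Rle_refl 1) L1 NE KD'.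
rewrite !Rmult_1_l Rmult_1_r in r1.
have := red_trans r1 (few_items_reduction t1 Dt Ks).
move=> h; have [||T [hT sT]] := red_solves _ _ h; try stdlra.
by exists T; split=> //; stdlra.
Qed.

Lemma many_items q u : 1 <= q -> q <= L -> K <= q * q * D ->
  D < 2 ^ ((4 + u) * (4 + u)) ->
  exists T, INR T <= 4002000 * (L * q) + 12 * L * INR u
            /\ solves_with_queries n m d k y T.
Proof.
move=> q1 qL Kq Du.
have h := red_trans (red_trans (coarse_reduction n0 d0 yI L1 q1 qL NE Kq)
  (fine_reduction n0 d0 yI L1 q1 qL NE))
  (tail_phase n0 d0 yI L1 NE u).
have p0 : 0 < 2 ^ ((4 + u) * (4 + u)) by apply: pow_lt; stdlra.
have p1 : 0 < / 2 ^ (4 + u).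
  by apply: Rinv_0_lt_compat; apply: pow_lt; stdlra.
have [||T [hT sT]] := red_solves _ _ h; try stdlra.
  apply: (Rmult_lt_reg_r (2 ^ ((4 + u) * (4 + u)))) => //.
  by rewrite /Rdiv Rmult_assoc Rinv_l; stdlra.
by exists T; split=> //; stdlra.
Qed.

End Assembly.

(** * Rounding, logarithms and comparison with the three bounds *)

Lemma nat_above x : 0 <= x -> exists u, x <= INR u <= x + 1.
Proof.
move=> /RleP x0; have /andP[/RleP h1 /RltP h2] := truncn_itv x0.
move: h1 h2; rewrite -!INRE S_INR => h1 h2.
by exists (Num.truncn x).+1; rewrite S_INR; stdlra.
Qed.

Lemma lg_ge1 x : 2 <= x -> 1 <= lg x.
Proof.
move=> x2; have l2 := ln_lt_2.
apply: (Rmult_le_reg_r (ln 2)); first by stdlra.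
rewrite /lg /Rdiv Rmult_assoc Rinv_l ?Rmult_1_r ?Rmult_1_l; last by stdlra.
have [lt|<-] := Rle_lt_or_eq_dec _ _ x2; last exact: Rle_refl.
by apply: Rlt_le; apply: ln_increasing; stdlra.
Qed.

Lemma le_pow2_lg x u : 0 < x -> lg x <= INR u -> x <= 2 ^ u.
Proof.
move=> x0 h; have l2 := ln_lt_2; have ln2 : 0 < ln 2 by stdlra.
have p0 : 0 < 2 ^ u by apply: pow_lt; stdlra.
apply: Rnot_lt_le => lt.
have := ln_increasing _ _ p0 lt; rewrite ln_pow; last by stdlra.
have : ln x <= INR u * ln 2.
  have -> : ln x = lg x * ln 2 by rewrite /lg; stdfield; stdlra.
  by apply: Rmult_le_compat_r; stdlra.
by stdlra.
Qed.

Lemma le_sqrt_of_sq x z : 0 <= x -> x * x <= z -> x <= sqrt z.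
Proof. by move=> x0 h; rewrite -(sqrt_square x) //; apply: sqrt_le_1_alt. Qed.

Lemma pow_expn a n : Nat.pow a n = expn a n.
Proof. by elim: n => //= n ->; rewrite expnS. Qed.

Theorem theorem2 :
  exists c : R, (0 < c)%R /\
  exists N0 : nat,
  forall n m d k : nat,
    (0 < n)%N -> (0 < m)%N -> (0 < d)%N -> (0 < k)%N ->
    (N0 <= 2 ^ n)%N -> (d * d <= 2 ^ n)%N -> (k * k <= 2 ^ n)%N ->
    forall y : {ffun 'I_k -> Bits m}, injective y ->
    exists T : nat,
      (INR T <= c * query_bound n d k)%R /\ solves_with_queries n m d k y T.
Proof.
(* Few items cost [4060000 L], the other cases at most [4002024] times the bound. *)
exists 5000000; split; first by stdlra.
exists 0%N => n m d k n0 _ d0 k0 _ dN kN y yI.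
rewrite pow_expn in dN kN.
set N := INR (expn 2 n); set D := INR d; set K := INR k.
have D1 : 1 <= D by rewrite -INR_1; apply: le_INR; apply/ssrnat.leP.
have K1 : 1 <= K by rewrite -INR_1; apply: le_INR; apply/ssrnat.leP.
have DN : D * D <= N by rewrite -mult_INR; apply: le_INR; apply/ssrnat.leP.
have KN : K * K <= N by rewrite -mult_INR; apply: le_INR; apply/ssrnat.leP.
have -> : query_bound n d k = if Rle_dec K (sqrt D) then sqrt (N / D)
  else if Rle_dec K (D * lg D) then sqrt (N * K * lg D / (D * Rmin K D))
  else sqrt (N * K) / D by rewrite /query_bound pow_expn.
have ND : 1 <= N / D.
  apply: (Rmult_le_reg_r D); first by stdlra.
  by rewrite /Rdiv Rmult_assoc Rinv_l; stdnra.
pose L := sqrt (N / D).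
have L1 : 1 <= L by rewrite -sqrt_1; apply: sqrt_le_1; stdlra.
have LL : L * L = N / D by apply: sqrt_sqrt; stdlra.
have NE : N = L * L * D by rewrite LL; stdfield; stdlra.
case: (Rle_dec K (sqrt D)) => [KD|nKD].
  apply: (few_items n0 d0 yI L1 NE).
  have sD : sqrt D * sqrt D = D by apply: sqrt_sqrt; stdlra.
  by rewrite -/K -/D -sD; apply: Rmult_le_compat; stdlra.
have KD := Rnot_le_lt _ _ nKD.
pose B := if Rle_dec K (D * lg D) then sqrt (N * K * lg D / (D * Rmin K D))
  else sqrt (N * K) / D.
rewrite -/B.
pose M := Rmax K D; pose q := sqrt (M / D).
have MD : D <= M by exact: Rmax_r.
have MK : K <= M by exact: Rmax_l.
have M1 : 1 <= M / D.
  apply: (Rmult_le_reg_r D); first by stdlra.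
  by rewrite /Rdiv Rmult_assoc Rinv_l; stdlra.
have q1 : 1 <= q by rewrite -sqrt_1; apply: sqrt_le_1; stdlra.
have qq : q * q = M / D by apply: sqrt_sqrt; stdlra.
have MN : M <= N by apply: Rmax_lub; stdnra.
have qL : q <= L.
  apply: sqrt_le_1_alt; apply: Rmult_le_compat_r => //.
  by apply: Rlt_le; apply: Rinv_0_lt_compat; stdlra.
have Kq : K <= q * q * D by rewrite qq /Rdiv Rmult_assoc Rinv_l; stdlra.
(* For [D = 1] the logarithm vanishes and, as [K > 1], only the third regime remains. *)
have lg1 : D = 1 \/ 1 <= lg D.
  have [d1|d2] := eqVneq d 1%N; first by left; rewrite /D d1.
  right; apply: lg_ge1; rewrite -[2]/(INR 2); apply: le_INR; apply/ssrnat.leP.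
  by rewrite ltn_neqAle eq_sym d2.
have lg11 : lg 1 = 0 by rewrite /lg ln_1 /Rdiv Rmult_0_l.
have lg0 : 0 <= lg D by case: lg1 => [->|]; stdlra.
(* [u >= sqrt (lg D)] gives [2 ^ (u * u) >= D], so [u] tail rounds bring the number of wanted
   addresses below 1. *)
have [u [u1 u2]] := nat_above (sqrt_pos (lg D)).
have Du : D < 2 ^ ((4 + u) * (4 + u)).
  apply: (Rle_lt_trans _ (2 ^ (u * u))).
    apply: le_pow2_lg; first by stdlra.
    by rewrite mult_INR -(sqrt_sqrt (lg D)) //; apply: Rmult_le_compat => //; exact: sqrt_pos.
  by apply: Rlt_pow; [stdlra | rewrite -!multE -plusE; nia].
have [T [hT sT]] := many_items n0 d0 yI L1 NE q1 qL Kq Du.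
exists T; split=> //.
(* Squares are compared: [N M / D ^ 2] and [N lg D / D] on the left. In the second regime
   [B ^ 2 = N M lg D / D ^ 2], as [K / Rmin K D = M / D]; in the third [M = K] and [D lg D < K]. *)
have [HB LB] : L * q <= B /\ L * sqrt (lg D) <= B.
  have L0 : 0 <= L * q by apply: Rmult_le_pos; stdlra.
  have S0 : 0 <= L * sqrt (lg D).
    by apply: Rmult_le_pos; [stdlra | exact: sqrt_pos].
  have Hsq : (L * q) * (L * q) = N / D * (M / D) by rewrite -LL -qq; stdring.
  have Ssq : (L * sqrt (lg D)) * (L * sqrt (lg D)) = N / D * lg D.
    by rewrite -LL -[in RHS](sqrt_sqrt (lg D)) //; stdring.
  rewrite /B; case: (Rle_dec K (D * lg D)) => [Klg|nKlg].
    have {}lg1 : 1 <= lg D.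
      by case: lg1 => // D1'; move: Klg; rewrite D1' lg11; stdlra.
    have -> : N * K * lg D / (D * Rmin K D) = N / D * (M / D) * lg D.
      rewrite /M /Rmax /Rmin; case: Rle_dec => _; stdfield; stdlra.
    have a1 : 1 <= N / D * (M / D) by stdnra.
    split; apply: le_sqrt_of_sq => //; first by rewrite Hsq; stdnra.
    rewrite Ssq; apply: Rmult_le_compat_r => //.
    by rewrite -[X in X <= _]Rmult_1_r; apply: Rmult_le_compat_l; stdlra.
  have Klg := Rnot_le_lt _ _ nKlg.
  have DK : D <= K by case: lg1 => [->|]; [stdlra | stdnra].
  have ME : M = K by apply: Rmax_left.
  split; apply: (Rmult_le_reg_r D); try stdlra;
    rewrite (_ : sqrt (N * K) / D * D = sqrt (N * K));
    try (by stdfield; stdlra); try stdlra;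
    apply: le_sqrt_of_sq; try by apply: Rmult_le_pos; stdlra.
    have -> : L * q * D * (L * q * D) = (L * q) * (L * q) * (D * D) by stdring.
    by rewrite Hsq ME; apply: Req_le; stdfield; stdlra.
  have -> : L * sqrt (lg D) * D * (L * sqrt (lg D) * D)
    = (L * sqrt (lg D)) * (L * sqrt (lg D)) * (D * D) by stdring.
  have -> : L * sqrt (lg D) * (L * sqrt (lg D)) * (D * D) = N * (D * lg D).
    by rewrite Ssq; stdfield; stdlra.
  by apply: Rmult_le_compat_l; [exact: pos_INR | stdlra].
have Lq : L <= L * q by stdnra.
apply: Rle_trans hT _.
have : L * INR u <= L * sqrt (lg D) + L by stdnra.
by stdlra.
Qed.
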